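(* For $w\in\mathbb{C}\setminus\{0\}$, $a\in\mathbb{R}$ and $\mathrm{Re}(s)>1$, $$\zeta_w(s,a)=\frac{2^{\frac{s+3}{2}}}{w^2\sqrt{\pi}(a-1)^{\frac{s-1}{2}}\Gamma(s)}\int_0^\infty\int_0^\infty\int_0^\infty \frac{(uv)^{\frac{s-1}{2}}}{u}\frac{e^{-(u^2+v^2)}\sin(wv)\sinh(wu)}{e^{y}-1}J_{\frac{s-1}{2}}\left(\frac{(a-1)vy}{u}\right)y^{\frac{s-1}{2}}\,dy\,du\,dv.$$
   Context: For $w\neq0$, $\mathrm{Re}(s)>1$, real $a$, $$\zeta_w(s,a):=\frac{4}{w^2\sqrt{\pi}\,\Gamma\left(\frac{s+1}{2}\right)}\sum_{n=1}^{\infty}\int_{0}^{\infty}\int_{0}^{\infty}\frac{(uv)^{s-1}e^{-(u^2+v^2)}\sin(wv)\sinh(wu)}{\left(n^2u^2+(a-1)^2v^2\right)^{s/2}}\,du\,dv.$$ $J_\nu$ is the Bessel function of the first kind; the product $(a-1)^{-\frac{s-1}{2}}J_{\frac{s-1}{2}}\left(\frac{(a-1)vy}{u}\right)$ is understood as the function of $a$ given by the power series $\sum_{m\ge0}\frac{(-1)^m(vy/(2u))^{2m+\frac{s-1}{2}}(a-1)^{2m}}{m!\,\Gamma(m+\frac{s+1}{2})}$ (so $a=1$ is allowed). *)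

(* Defs.v *)
From HB Require Import structures.
From mathcomp Require Import all_boot all_order all_algebra.
From mathcomp Require Import complex.
From mathcomp Require Import all_classical all_reals all_analysis.
From mathcomp Require Import ring.

Set Implicit Arguments.
Unset Strict Implicit.
Unset Printing Implicit Defensive.

Import Order.TTheory GRing.Theory Num.Theory.
Import numFieldNormedType.Exports.

Local Open Scope classical_set_scope.
Local Open Scope ring_scope.
Local Open Scope complex_scope.

Section complex_functions.
Variable R : realType.
Implicit Types (x y : R) (z w s nu : R[i]).

Definition cexp z : R[i] :=
  (expR (complex.Re z))%:C * (cos (complex.Im z) +i* sin (complex.Im z)).

Definition csin z : R[i] := (cexp ('i%C * z) - cexp (- ('i%C * z))) / (2 * 'i%C).

Definition csinh z : R[i] := (cexp z - cexp (- z)) / 2.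

(* Principal value x^z for a base x > 0 (the value at x <= 0 is irrelevant:
   [ln] is 0 there). *)
Definition cpow x z : R[i] := cexp (z * (ln x)%:C).

(* Lebesgue integral over ]0, +oo[ of a complex-valued function. *)
Definition cint (f : R -> R[i]) : R[i] :=
  (\int[lebesgue_measure]_(x in `]0, +oo[) complex.Re (f x)) +i*
  (\int[lebesgue_measure]_(x in `]0, +oo[) complex.Im (f x)).

(* The norm topology on [R[i]] is carried by its alias [R[i]^o]. *)
Definition clim (u : nat -> R[i]) : R[i] := limn (u : nat -> R[i]^o).

(* Euler's integral: this is the Gamma function on the half-plane Re z > 0. *)
Definition cGamma z : R[i] :=
  cint (fun t => cpow t (z - 1) * (expR (- t))%:C).

(* Bessel function of the first kind J_nu(x), for x > 0 and Re nu > -1. *)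
Definition besselJ nu x : R[i] :=
  clim (fun N => \sum_(0 <= m < N)
    (-1) ^+ m * cpow (x / 2) (2 * m%:R + nu)
      / (m`!%:R * cGamma (m%:R + nu + 1))).

(* c^(- nu) * J_nu (c * x) for x > 0, as the power series in c obtained by
   cancelling c^nu; it is defined for every real c, including c <= 0.
   See [besselJ_quotE] for c > 0. *)
Definition besselJ_quot nu c x : R[i] :=
  clim (fun N => \sum_(0 <= m < N)
    (-1) ^+ m * cpow (x / 2) (2 * m%:R + nu) * c%:C ^+ (2 * m)
      / (m`!%:R * cGamma (m%:R + nu + 1))).

Definition zeta_w w s (a : R) : R[i] :=
  4 / (w ^+ 2 * (Num.sqrt pi)%:C * cGamma ((s + 1) / 2)) *
  clim (fun N => \sum_(1 <= n < N.+1)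
    cint (fun v => cint (fun u =>
      cpow (u * v) (s - 1) * (expR (- (u ^+ 2 + v ^+ 2)))%:C
        * csin (w * v%:C) * csinh (w * u%:C)
        / cpow (n%:R ^+ 2 * u ^+ 2 + (a - 1) ^+ 2 * v ^+ 2) (s / 2)))).

Lemma cexpD z w : cexp (z + w) = cexp z * cexp w.
Proof.
case: z w => [a b] [c d]; rewrite /cexp /= expRD cosD sinD.
by simpc; apply/eqP; rewrite eq_complex /=; apply/andP; split; apply/eqP; ring.
Qed.

Lemma cexp0 : cexp 0 = 1.
Proof. by rewrite /cexp /= expR0 cos0 sin0 mul1r. Qed.

Lemma cpowD x z w : cpow x (z + w) = cpow x z * cpow x w.
Proof. by rewrite /cpow mulrDl cexpD. Qed.

Lemma cpowMl x y z : 0 < x -> 0 < y -> cpow (x * y) z = cpow x z * cpow y z.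
Proof.
by move=> x0 y0; rewrite /cpow lnM ?posrE// rmorphD mulrDr cexpD.
Qed.

Lemma cpow1 x : 0 < x -> cpow x 1 = x%:C.
Proof.
by move=> x0; rewrite /cpow mul1r /cexp /= lnK ?posrE// cos0 sin0 mulr1.
Qed.

Lemma cpow_natr x n : 0 < x -> cpow x n%:R = x%:C ^+ n.
Proof.
move=> x0; elim: n => [|n ih]; first by rewrite /cpow mul0r cexp0.
by rewrite -natr1 cpowD ih cpow1// exprSr.
Qed.

Lemma climZ (k : R[i]) (u : nat -> R[i]) :
  k != 0 -> clim (fun n => k * u n) = k * clim u.
Proof.
move=> k0; rewrite /clim; set U : nat -> R[i]^o := u.
have [cu|dvu] := pselect (cvgn U).
  exact: (@limZl_tmp _ _ _ _ _ k U cu).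
rewrite [in RHS]/lim /lim_in getPN; last first.
  by move=> x /cvgP.
rewrite [in LHS]/lim /lim_in getPN; last first.
  move=> x /cvgP h; apply: dvu.
  by move: h; rewrite -(@is_cvgZlE _ _ _ _ _ k U k0).
have -> : point = 0 :> R[i]^o by [].
by rewrite mulr0.
Qed.

Lemma besselJ_quotE nu (c : R) x : 0 < c -> 0 < x ->
  besselJ_quot nu c x = cpow c (- nu) * besselJ nu (c * x).
Proof.
move=> c0 x0; rewrite -climZ; last first.
  apply/eqP => p0; have := cpowD c (- nu) nu.
  by rewrite addNr p0 mul0r /cpow mul0r cexp0 => /eqP; rewrite oner_eq0.
congr clim; apply/funext => N; rewrite mulr_sumr; apply: eq_bigr => m _.
rewrite -(mulrA c) (cpowMl _ c0) ?divr_gt0// [in RHS](cpowD c).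
rewrite -natrM cpow_natr//.
have : cpow c (- nu) * cpow c nu = 1.
  by rewrite -cpowD addNr /cpow mul0r cexp0.
set p := cpow c (- nu); set q := cpow c nu => pq.
transitivity ((p * q) * ((-1) ^+ m * cpow (x / 2) ((2 * m)%:R + nu) * 
   c%:C ^+ (2 * m) / (m`!%:R * cGamma (m%:R + nu + 1)))); last by ring.
by rewrite pq mul1r.
Qed.

End complex_functions.

(* Main.v *)
(* Write nu = (s - 1) / 2 and h(x) = 0F1(; nu + 1; - x), so that
   J_nu(x) = (x / 2)^nu h(x^2 / 4) / Gamma(nu + 1).  Since
   1 / (e^y - 1) = sum_(n >= 1) e^(- n y), the integral in y reduces to
     int_0^oo e^(- al y) y^(s - 1) h(b y^2) dy = Gamma(s) (al^2 + 4 b)^(- s / 2)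
   for al = n and 4 b = ((a - 1) v / u)^2, whose sum over n is the integrand of
   zeta_w up to constants.  Integrating h term by term only proves this formula
   for 4 b < al^2.  Instead, integration by parts and the contiguous relation of
   h show that both sides solve the same linear equation along a path in (al, b)
   that starts at (1, 0), where the formula is the definition of Gamma(s).
   Domination comes from |h| <= 1 on [0, +oo[; no property of Gamma is needed
   beyond Gamma(z + 1) = z Gamma(z) and Gamma(z) <> 0 for Re z > 0. *)

Require Import Defs.
From mathcomp Require Import all_boot all_order all_algebra.
From mathcomp Require Import complex.
From mathcomp Require Import all_classical all_reals all_analysis.
From mathcomp Require Import measurable_realfun ring lra.

Import Order.TTheory GRing.Theory Num.Theory.
Import numFieldNormedType.Exports.
Local Open Scope ring_scope.
Local Open Scope complex_scope.
Local Open Scope classical_set_scope.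
Import ComplexField.Normc.
Local Notation Re := (complex.Re).
Local Notation Im := (complex.Im).

(** Both sides integrate over v outside and u inside, with y innermost on the right, so the order of
    integration never changes. Only the sum over n moves, by dominated convergence in y, then in u,
    then in v. The dominating functions come from partial sums, not from single terms: the geometric
    sum stays below 1 / (e^y - 1) <= e^(- y / 2) / y uniformly in N, and y^(Re s - 2) e^(- y / 2) is
    integrable at 0 exactly because Re s > 1. The same hypothesis puts nu in the range Re nu >= 0
    where |h| <= 1 is proved. In u, the apparent pole 1 / u is compensated by sinh(w u) = O(u), and
    the Gaussian absorbs the exponential growth of sin and sinh. Gamma is available only as Euler's
    integral. It is the case al = 1, b = 0 of the integrals under study, so its functional equation
    comes out of the same integration by parts as the Bessel identities. *)

(** * Complex arithmetic through real and imaginary parts *)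

Section complex_numbers.
Context {R : realType}.
Implicit Types (z w : R[i]) (x y : R).

Lemma ReD z w : Re (z + w) = Re z + Re w. Proof. by case: z w => ? ? []. Qed.
Lemma ImD z w : Im (z + w) = Im z + Im w. Proof. by case: z w => ? ? []. Qed.
Lemma ReN z : Re (- z) = - Re z. Proof. by case: z. Qed.
Lemma ImN z : Im (- z) = - Im z. Proof. by case: z. Qed.
Lemma ReM z w : Re (z * w) = Re z * Re w - Im z * Im w.
Proof. by case: z w => ? ? []. Qed.
Lemma ImM z w : Im (z * w) = Re z * Im w + Im z * Re w.
Proof. by case: z w => ? ? []. Qed.

Lemma Re_sum I (r : seq I) (F : I -> R[i]) :
  Re (\sum_(i <- r) F i) = \sum_(i <- r) Re (F i).
Proof. by elim/big_rec2: _ => // i a b _ <-; rewrite ReD. Qed.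
Lemma Im_sum I (r : seq I) (F : I -> R[i]) :
  Im (\sum_(i <- r) F i) = \sum_(i <- r) Im (F i).
Proof. by elim/big_rec2: _ => // i a b _ <-; rewrite ImD. Qed.

Lemma Re_nat n : Re (n%:R : R[i]) = n%:R.
Proof. by elim: n => // n ih; rewrite -natr1 ReD ih /= natr1. Qed.
Lemma Im_nat n : Im (n%:R : R[i]) = 0.
Proof. by elim: n => // n ih; rewrite -natr1 ImD ih /= addr0. Qed.

Lemma real_natr n : (n%:R)%:C = n%:R :> R[i]. Proof. exact: rmorph_nat. Qed.
Lemma realX x n : (x ^+ n)%:C = x%:C ^+ n. Proof. exact: rmorphXn. Qed.
Lemma realD x y : (x + y)%:C = x%:C + y%:C. Proof. exact: rmorphD. Qed.
Lemma realN x : (- x)%:C = - x%:C. Proof. exact: rmorphN. Qed.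
Lemma realM x y : (x * y)%:C = x%:C * y%:C. Proof. exact: rmorphM. Qed.
Lemma realV x : (x^-1)%:C = x%:C^-1. Proof. exact: fmorphV. Qed.
Definition realE := (real_natr, realX, realN, realD, realM).

Lemma complex_ext z w : Re z = Re w -> Im z = Im w -> z = w.
Proof. by case: z w => ? ? [? ?] /= -> ->. Qed.

Lemma Re_half z : Re (z / 2) = Re z / 2.
Proof.
have -> : (2 : R[i])^-1 = (2^-1)%:C by rewrite fmorphV /= rmorphMn.
by rewrite ReM /= mulr0 subr0.
Qed.

Lemma Im_half z : Im (z / 2) = Im z / 2.
Proof.
have -> : (2 : R[i])^-1 = (2^-1)%:C by rewrite fmorphV /= rmorphMn.
by rewrite ImM /= mulr0 add0r.
Qed.

Lemma Re_mul_real z x : Re (z * x%:C) = Re z * x.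
Proof. by rewrite ReM /= mulr0 subr0. Qed.
Lemma Im_mul_real z x : Im (z * x%:C) = Im z * x.
Proof. by rewrite ImM /= mulr0 add0r. Qed.

Lemma Re_cexp z : Re (cexp z) = expR (Re z) * cos (Im z).
Proof. by case: z => a b; rewrite ReM /= mul0r subr0. Qed.
Lemma Im_cexp z : Im (cexp z) = expR (Re z) * sin (Im z).
Proof. by case: z => a b; rewrite ImM /= mul0r addr0. Qed.

Lemma normcE z : normc z = Num.sqrt (Re z ^+ 2 + Im z ^+ 2).
Proof. by case: z. Qed.
Lemma normc_ge0 z : 0 <= normc z. Proof. by rewrite normcE sqrtr_ge0. Qed.
Lemma sqr_normc z : normc z ^+ 2 = Re z ^+ 2 + Im z ^+ 2.
Proof. by rewrite normcE sqr_sqrtr// addr_ge0 ?sqr_ge0. Qed.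
Lemma normr_normc z : `|z| = (normc z)%:C.
Proof. by rewrite normc_def normcE. Qed.

Lemma normr_Re_le z : `|Re z| <= normc z.
Proof. by rewrite -sqrtr_sqr normcE ler_wsqrtr// lerDl sqr_ge0. Qed.
Lemma normr_Im_le z : `|Im z| <= normc z.
Proof. by rewrite -sqrtr_sqr normcE ler_wsqrtr// lerDr sqr_ge0. Qed.
Lemma normc_le z : normc z <= `|Re z| + `|Im z|.
Proof.
rewrite -[leRHS]ger0_norm ?addr_ge0// -sqrtr_sqr normcE ler_wsqrtr//.
by rewrite sqrrD !real_normK ?num_real// addrAC lerDl mulrn_wge0 ?mulr_ge0.
Qed.
Lemma normc_real x : normc x%:C = `|x|.
Proof. by rewrite /normc /= expr0n addr0 sqrtr_sqr. Qed.
Lemma normc_cexp z : normc (cexp z) = expR (Re z).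
Proof.
rewrite normcE Re_cexp Im_cexp !exprMn -mulrDr cos2Dsin2 mulr1 sqrtr_sqr.
by rewrite ger0_norm ?expR_ge0.
Qed.
Lemma normc_sum I (r : seq I) (F : I -> R[i]) :
  normc (\sum_(i <- r) F i) <= \sum_(i <- r) normc (F i).
Proof.
elim/big_rec2: _ => [|i a b _ ih]; first by rewrite normc_real normr0.
by rewrite (le_trans (le_normcD _ _))// lerD2l.
Qed.

Lemma cexp_neq0 z : cexp z != 0.
Proof.
apply/eqP => /(congr1 (@normc R)); rewrite normc_cexp normc_real normr0.
by move/eqP; rewrite gt_eqF ?expR_gt0.
Qed.
Lemma cexpN z : cexp (- z) = (cexp z)^-1.
Proof. by apply: (mulfI (cexp_neq0 z)); rewrite -cexpD subrr cexp0 divff// cexp_neq0. Qed.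

Lemma normc_cpow x z : normc (cpow x z) = expR (Re z * ln x).
Proof. by rewrite normc_cexp ReM /= mulr0 subr0. Qed.
Lemma cpow_neq0 x z : cpow x z != 0. Proof. exact: cexp_neq0. Qed.
Lemma cpowN x z : cpow x (- z) = (cpow x z)^-1.
Proof. by rewrite /cpow mulNr cexpN. Qed.
Lemma cpow_sqr x z : 0 < x -> cpow (x ^+ 2) (z / 2) = cpow x z.
Proof.
by move=> x0; rewrite expr2 cpowMl// -cpowD -splitr.
Qed.
Lemma cpow_inv x z : 0 < x -> cpow x^-1 z = (cpow x z)^-1.
Proof. by move=> x0; rewrite -cpowN /cpow lnV ?posrE// rmorphN mulrN mulNr. Qed.
End complex_numbers.

(** * Limits and measurability of complex functions, by components *)

Section complex_limits.
Context {R : realType}.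
Implicit Types (u v : nat -> R[i]) (k l m : R[i]).

(** Componentwise, so that real limit theorems apply directly; [ccvg_clim] returns to the norm
    topology in which [clim] is taken. *)
Definition ccvg u l :=
  ((fun n => Re (u n)) @ \oo --> Re l) /\ ((fun n => Im (u n)) @ \oo --> Im l).

Lemma ccvg_clim u l : ccvg u l -> clim u = l.
Proof.
move=> [ure uim]; apply: (@cvg_lim R[i]^o) => //.
apply/cvgrPdist_le => /= e e0.
(* In the partial order of [R[i]], a positive element is real. *)
have [ere eim] : (0 < Re e) /\ Im e = 0.
  by move: e0; rewrite ltcE /= => /andP[/eqP -> ->].
have e20 : 0 < Re e / 2 by rewrite divr_gt0.
move/cvgrPdist_le : ure => /(_ _ e20) ure.
move/cvgrPdist_le : uim => /(_ _ e20) uim.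
near=> n.
rewrite [X in X <= _]normr_normc.
have -> : e = (Re e)%:C by apply: complex_ext.
rewrite lecR (le_trans (normc_le _))// ReD ImD ReN ImN (splitr (Re e)).
by rewrite lerD//; near: n.
Unshelve. all: by end_near. Qed.

Lemma ccvgMl k u l : ccvg u l -> ccvg (fun n => k * u n) (k * l).
Proof.
move=> [ure uim]; split.
  rewrite ReM; under eq_fun do rewrite ReM.
  by apply: cvgB; apply: cvgMr.
rewrite ImM; under eq_fun do rewrite ImM.
by apply: cvgD; apply: cvgMr.
Qed.

Lemma ccvgD u v l m : ccvg u l -> ccvg v m -> ccvg (fun n => u n + v n) (l + m).
Proof.
move=> [ur ui] [vr vi]; split.
  by rewrite ReD; under eq_fun do rewrite ReD; exact: cvgD.
by rewrite ImD; under eq_fun do rewrite ImD; exact: cvgD.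
Qed.

Lemma ccvg_unique u l m : ccvg u l -> ccvg u m -> l = m.
Proof. by move=> /ccvg_clim <- /ccvg_clim <-. Qed.

Lemma eq_ccvg u v l : u =1 v -> ccvg u l -> ccvg v l.
Proof. by move=> /funext <-. Qed.

End complex_limits.

Section complex_measurability.
Context {R : realType} {d} {T : measurableType d}.
Implicit Types (f g : T -> R[i]) (h : T -> R).

Definition cmeas f :=
  measurable_fun setT (fun x => Re (f x)) /\ measurable_fun setT (fun x => Im (f x)).

Lemma cmeas_cst z : cmeas (fun=> z).
Proof. by split; exact: measurable_cst. Qed.

Lemma cmeas_real h : measurable_fun setT h -> cmeas (fun x => (h x)%:C).
Proof. by split=> //=; exact: measurable_cst. Qed.

Lemma cmeasD f g : cmeas f -> cmeas g -> cmeas (fun x => f x + g x).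
Proof.
move=> [fr fi] [gr gi]; split.
  by under eq_fun do rewrite ReD; exact: measurable_funD.
by under eq_fun do rewrite ImD; exact: measurable_funD.
Qed.

Lemma cmeasM f g : cmeas f -> cmeas g -> cmeas (fun x => f x * g x).
Proof.
move=> [fr fi] [gr gi]; split.
  under eq_fun do rewrite ReM.
  by apply: measurable_funB; exact: measurable_funM.
under eq_fun do rewrite ImM.
by apply: measurable_funD; exact: measurable_funM.
Qed.

Lemma cmeasN f : cmeas f -> cmeas (fun x => - f x).
Proof.
by move=> mf; under eq_fun do rewrite -mulN1r; exact: cmeasM (cmeas_cst _) mf.
Qed.

Lemma cmeas_sum I (r : seq I) (F : I -> T -> R[i]) :
  (forall i, cmeas (F i)) -> cmeas (fun x => \sum_(i <- r) F i x).
Proof.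
move=> mF; elim: r => [|i r ih].
  by under eq_fun do rewrite big_nil; exact: cmeas_cst.
by under eq_fun do rewrite big_cons; exact: cmeasD.
Qed.

Lemma cmeas_cexp f : cmeas f -> cmeas (fun x => cexp (f x)).
Proof.
move=> [fr fi]; split.
  under eq_fun do rewrite Re_cexp.
  apply: measurable_funM.
    by apply: (measurableT_comp (f := @expR R)).
  apply: (measurableT_comp (f := @cos R)) => //.
  by apply: continuous_measurable_fun; exact: continuous_cos.
under eq_fun do rewrite Im_cexp.
apply: measurable_funM.
  by apply: (measurableT_comp (f := @expR R)).
apply: (measurableT_comp (f := @sin R)) => //.
by apply: continuous_measurable_fun; exact: continuous_sin.
Qed.

Lemma cmeas_cpow h z : measurable_fun setT h -> cmeas (fun x => cpow (h x) z).
Proof.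
move=> mh; apply: cmeas_cexp; apply: cmeasM (cmeas_cst _) _.
apply: cmeas_real; apply: (measurableT_comp (f := @ln R)) => //.
Qed.

Lemma cmeas_csin f : cmeas f -> cmeas (fun x => csin (f x)).
Proof.
move=> mf; rewrite /csin; apply: cmeasM (cmeas_cst _).
have mif : cmeas (fun x => 'i%C * f x) by exact: cmeasM (cmeas_cst _) mf.
by apply: cmeasD; [|apply: cmeasN]; apply: cmeas_cexp => //; exact: cmeasN.
Qed.

Lemma cmeas_csinh f : cmeas f -> cmeas (fun x => csinh (f x)).
Proof.
move=> mf; rewrite /csinh; apply: cmeasM (cmeas_cst _).
by apply: cmeasD; [|apply: cmeasN]; apply: cmeas_cexp => //; exact: cmeasN.
Qed.
End complex_measurability.

(** * Integration and dominated convergence on the half-line *)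

Section complex_integrals.
Context {R : realType}.
Local Notation mu := (@lebesgue_measure R).
Local Notation D := (`]0, +oo[%classic : set R).
Implicit Types (f : R -> R[i]) (g : R -> R) (k : R[i]).

Lemma measurable_half_line : measurable (D : set (measurableTypeR R)).
Proof. exact: measurable_itv. Qed.

Lemma half_line_gt0 x : D x -> 0 < x.
Proof. by rewrite /= in_itv /= andbT. Qed.

Definition cintegrable f :=
  mu.-integrable D (EFin \o (fun x => Re (f x))) /\
  mu.-integrable D (EFin \o (fun x => Im (f x))).

Lemma dominated_Rintegrable g (h : R -> R) : measurable_fun setT h ->
  mu.-integrable D (EFin \o g) -> (forall x, 0 < x -> `|h x| <= g x) ->
  mu.-integrable D (EFin \o h).
Proof.
move=> mh ig hg; apply: le_integrable ig => //.
  by apply/measurable_EFinP; apply: measurable_funS mh.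
move=> x /half_line_gt0 x0; rewrite lee_fin /=.
by rewrite (le_trans (hg _ x0))// ler_norm.
Qed.

Lemma dominated_cintegrable f g : cmeas f ->
  mu.-integrable D (EFin \o g) -> (forall x, 0 < x -> normc (f x) <= g x) ->
  cintegrable f.
Proof.
move=> [mr mi] ig fg; split; apply: (@dominated_Rintegrable g) => // x x0.
  by rewrite (le_trans (normr_Re_le _))// fg.
by rewrite (le_trans (normr_Im_le _))// fg.
Qed.

Lemma eq_cint f1 f2 : (forall x, 0 < x -> f1 x = f2 x) -> cint f1 = cint f2.
Proof.
move=> f12; rewrite /cint; congr (_ +i* _);
  by apply: eq_Rintegral => x; rewrite inE => /half_line_gt0 x0; rewrite f12.
Qed.

Lemma RintegrableD g1 g2 : mu.-integrable D (EFin \o g1) ->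
  mu.-integrable D (EFin \o g2) -> mu.-integrable D (EFin \o (fun x => g1 x + g2 x)).
Proof. by move=> i1 i2; have := integrableD measurable_half_line i1 i2. Qed.

Lemma RintegrableZ g (c : R) : mu.-integrable D (EFin \o g) ->
  mu.-integrable D (EFin \o (fun x => c * g x)).
Proof. by move=> ig; have := integrableZl measurable_half_line c ig. Qed.

Lemma RintegrableB g1 g2 : mu.-integrable D (EFin \o g1) ->
  mu.-integrable D (EFin \o g2) -> mu.-integrable D (EFin \o (fun x => g1 x - g2 x)).
Proof. by move=> i1 i2; have := integrableB measurable_half_line i1 i2. Qed.

Lemma eq_Rintegrable g1 g2 : g1 =1 g2 -> mu.-integrable D (EFin \o g1) ->
  mu.-integrable D (EFin \o g2).
Proof. by move=> /funext ->. Qed.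

Lemma cintegrableD f1 f2 : cintegrable f1 -> cintegrable f2 ->
  cintegrable (fun x => f1 x + f2 x).
Proof.
move=> [r1 i1] [r2 i2]; split.
  by apply: eq_Rintegrable (RintegrableD _ _ r1 r2) => x; rewrite ReD.
by apply: eq_Rintegrable (RintegrableD _ _ i1 i2) => x; rewrite ImD.
Qed.

Lemma cintD f1 f2 : cintegrable f1 -> cintegrable f2 ->
  cint (fun x => f1 x + f2 x) = cint f1 + cint f2.
Proof.
move=> [r1 i1] [r2 i2]; apply: complex_ext.
  rewrite ReD /= -RintegralD//.
  by apply: eq_Rintegral => x _; rewrite ReD.
rewrite ImD /= -RintegralD//.
by apply: eq_Rintegral => x _; rewrite ImD.
Qed.

Lemma cintegrableMl k f : cintegrable f -> cintegrable (fun x => k * f x).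
Proof.
move=> [r i]; split.
  apply: eq_Rintegrable (RintegrableB _ _ (RintegrableZ _ (Re k) r)
    (RintegrableZ _ (Im k) i)) => x.
  by rewrite ReM.
apply: eq_Rintegrable (RintegrableD _ _ (RintegrableZ _ (Re k) i)
  (RintegrableZ _ (Im k) r)) => x.
by rewrite ImM.
Qed.

Lemma cintMl k f : cintegrable f -> cint (fun x => k * f x) = k * cint f.
Proof.
move=> [r i]; apply: complex_ext.
  rewrite ReM /= -!RintegralZl// -RintegralB//; [|exact: RintegrableZ..].
  by apply: eq_Rintegral => x _; rewrite ReM.
rewrite ImM /= -!RintegralZl// -RintegralD//; [|exact: RintegrableZ..].
by apply: eq_Rintegral => x _; rewrite ImM.
Qed.

Lemma cint0 : cint (fun=> 0 : R[i]) = 0.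
Proof. by rewrite /cint /= /Rintegral integral0. Qed.

Lemma cint_sum I (r : seq I) (F : I -> R -> R[i]) :
  (forall i, cintegrable (F i)) ->
  cintegrable (fun x => \sum_(i <- r) F i x) /\
  cint (fun x => \sum_(i <- r) F i x) = \sum_(i <- r) cint (F i).
Proof.
move=> iF; elim: r => [|i r [ih1 ih2]].
  have -> : (fun x => \sum_(i <- [::]) F i x) = (fun=> 0).
    by apply/funext => x; rewrite big_nil.
  by rewrite big_nil cint0; split=> //; split; exact: integrable0.
have -> : (fun x => \sum_(j <- i :: r) F j x) =
    (fun x => F i x + \sum_(j <- r) F j x).
  by apply/funext => x; rewrite big_cons.
by rewrite big_cons -ih2 cintD//; split=> //; exact: cintegrableD.
Qed.

(** The factor 2 comes from estimating real and imaginary parts separately; it is harmless because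
    only a finite bound is wanted. *)
Lemma normc_cint_le f g : cmeas f ->
  mu.-integrable D (EFin \o g) -> (forall x, 0 < x -> normc (f x) <= g x) ->
  normc (cint f) <= 2 * \int[mu]_(x in D) g x.
Proof.
move=> mf ig fg; have [ir ii] := dominated_cintegrable _ _ mf ig fg.
rewrite (le_trans (normc_le _))// mulr_natl mulr2n lerD//=.
  rewrite (le_trans (le_normr_Rintegral measurable_half_line ir))// le_Rintegral//.
    by have := integrable_abse ir.
  by move=> x /half_line_gt0 x0; rewrite (le_trans (normr_Re_le _))// fg.
rewrite (le_trans (le_normr_Rintegral measurable_half_line ii))// le_Rintegral//.
  by have := integrable_abse ii.
by move=> x /half_line_gt0 x0; rewrite (le_trans (normr_Im_le _))// fg.
Qed.

Lemma Rintegral_dominated_cvg (u : nat -> R -> R) (h g : R -> R) :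
  (forall n, measurable_fun setT (u n)) -> mu.-integrable D (EFin \o g) ->
  (forall n x, 0 < x -> `|u n x| <= g x) ->
  (forall x, 0 < x -> u ^~ x @ \oo --> h x) ->
  mu.-integrable D (EFin \o h) /\
  (fun n => \int[mu]_(x in D) u n x) @ \oo --> \int[mu]_(x in D) h x.
Proof.
move=> mun ig ug uh.
have mu' n : measurable_fun D (EFin \o u n).
  by apply/measurable_EFinP; apply: measurable_funS (mun n).
have uh' x : D x -> (EFin \o u n) x @[n --> \oo] --> (EFin \o h) x.
  by move=> /half_line_gt0 x0; apply: cvg_EFin; [exact: nearW|exact: uh].
have mh : measurable_fun D (EFin \o h) by exact: emeasurable_fun_cvg mu' uh'.
have uh_ae : {ae mu, forall x, D x -> (EFin \o u n) x @[n --> \oo] --> (EFin \o h) x}.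
  exact: aeW.
have ug_ae : {ae mu, forall x n, D x -> (`|(EFin \o u n) x| <= (EFin \o g) x)%E}.
  by apply: aeW => x n /half_line_gt0 x0; rewrite lee_fin; exact: ug.
have [ih _ cvg] := dominated_convergence measurable_half_line mu' mh uh_ae ig ug_ae.
by split=> //; apply: fine_cvg; rewrite fineK//; exact: integrable_fin_num.
Qed.

Lemma cint_dominated_cvg (u : nat -> R -> R[i]) f g :
  (forall n, cmeas (u n)) -> mu.-integrable D (EFin \o g) ->
  (forall n x, 0 < x -> normc (u n x) <= g x) ->
  (forall x, 0 < x -> ccvg (u ^~ x) (f x)) ->
  cintegrable f /\ ccvg (fun n => cint (u n)) (cint f).
Proof.
move=> mun ig ug uf.
have [] := @Rintegral_dominated_cvg (fun n x => Re (u n x)) (fun x => Re (f x)) g.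
- by move=> n; have [] := mun n.
- by [].
- by move=> n x x0; rewrite (le_trans (normr_Re_le _))// ug.
- by move=> x /uf[].
move=> ir cr.
have [] := @Rintegral_dominated_cvg (fun n x => Im (u n x)) (fun x => Im (f x)) g.
- by move=> n; have [] := mun n.
- by [].
- by move=> n x x0; rewrite (le_trans (normr_Im_le _))// ug.
- by move=> x /uf[].
by move=> ii ci.
Qed.
End complex_integrals.

(** * Derivatives of real functions and of complex functions of a real variable *)

Section real_derivatives.
Context {R : realType}.
Implicit Types (f g : R -> R) (x a b : R).

Definition rder f x a := is_derive x (1 : R) f a.

Lemma rder_eq f x a b : a = b -> rder f x a -> rder f x b.
Proof. by move=> ->. Qed.

Lemma eq_rder f g x a : f =1 g -> rder f x a -> rder g x a.
Proof. by move=> /funext ->. Qed.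

Lemma rder_cst (k : R) x : rder (fun=> k) x 0.
Proof. exact: is_derive_cst. Qed.

Lemma rder_id x : rder (fun y => y) x 1.
Proof. exact: is_derive_id. Qed.

Lemma rderD f g x a b : rder f x a -> rder g x b ->
  rder (fun y => f y + g y) x (a + b).
Proof. exact: is_deriveD. Qed.

Lemma rderB f g x a b : rder f x a -> rder g x b ->
  rder (fun y => f y - g y) x (a - b).
Proof. exact: is_deriveB. Qed.

Lemma rderM f g x a b : rder f x a -> rder g x b ->
  rder (fun y => f y * g y) x (a * g x + f x * b).
Proof.
move=> fa gb; apply: rder_eq (is_deriveM fa gb).
by rewrite addrC mulrC.
Qed.

Lemma rder_comp f g x a b : rder f (g x) a -> rder g x b ->
  rder (fun y => f (g y)) x (a * b).
Proof. exact: is_derive1_comp. Qed.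

Lemma rder_sqr x : rder (fun y => y ^+ 2) x (2 * x).
Proof.
apply: eq_rder (rder_eq _ _ _ _ _ (rderM _ _ _ _ _ (rder_id x) (rder_id x))).
  by move=> y; rewrite expr2.
by rewrite mul1r mulr1 mulr2n mulrDl mul1r.
Qed.

Lemma rder_continuous f x a : rder f x a -> {for x, continuous f}.
Proof. by move=> [/derivable1_diffP /differentiable_continuous]. Qed.
End real_derivatives.

Section complex_derivatives.
Context {R : realType}.
Implicit Types (f g : R -> R[i]) (x : R) (a b : R[i]).

Definition cder f x a :=
  rder (fun y => Re (f y)) x (Re a) /\ rder (fun y => Im (f y)) x (Im a).

Lemma cder_eq f x a b : a = b -> cder f x a -> cder f x b.
Proof. by move=> ->. Qed.

Lemma eq_cder f g x a : f =1 g -> cder f x a -> cder g x a.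
Proof. by move=> /funext ->. Qed.

Lemma cder_cst (k : R[i]) x : cder (fun=> k) x 0.
Proof. by split; exact: rder_cst. Qed.

Lemma cder_real (h : R -> R) x (c : R) : rder h x c -> cder (fun y => (h y)%:C) x c%:C.
Proof. by move=> hc; split=> //; exact: rder_cst. Qed.

Lemma cderD f g x a b : cder f x a -> cder g x b ->
  cder (fun y => f y + g y) x (a + b).
Proof.
move=> [fr fi] [gr gi]; split.
  by rewrite ReD; apply: eq_rder (rderD _ _ _ _ _ fr gr) => y; rewrite ReD.
by rewrite ImD; apply: eq_rder (rderD _ _ _ _ _ fi gi) => y; rewrite ImD.
Qed.

Lemma cderM f g x a b : cder f x a -> cder g x b ->
  cder (fun y => f y * g y) x (a * g x + f x * b).
Proof.
move=> [fr fi] [gr gi]; split.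
  apply: eq_rder (rder_eq _ _ _ _ _
    (rderB _ _ _ _ _ (rderM _ _ _ _ _ fr gr) (rderM _ _ _ _ _ fi gi))).
    by move=> y; rewrite ReM.
  by rewrite ReD !ReM; ring.
apply: eq_rder (rder_eq _ _ _ _ _
  (rderD _ _ _ _ _ (rderM _ _ _ _ _ fr gi) (rderM _ _ _ _ _ fi gr))).
  by move=> y; rewrite ImM.
by rewrite ImD !ImM; ring.
Qed.

Lemma cder_comp f (h : R -> R) x a (c : R) : cder f (h x) a -> rder h x c ->
  cder (fun y => f (h y)) x (c%:C * a).
Proof.
move=> [fr fi] hc; split.
  apply: rder_eq (rder_comp _ _ _ _ _ fr hc).
  by rewrite ReM /= mul0r subr0 mulrC.
apply: rder_eq (rder_comp _ _ _ _ _ fi hc).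
by rewrite ImM /= mul0r addr0 mulrC.
Qed.

Lemma cder_cexp f x a : cder f x a -> cder (fun y => cexp (f y)) x (a * cexp (f x)).
Proof.
move=> [fr fi].
have er := rder_comp _ _ _ _ _ (is_derive_expR _) fr.
have ec := rder_comp _ _ _ _ _ (is_derive_cos _) fi.
have es := rder_comp _ _ _ _ _ (is_derive_sin _) fi.
split.
  apply: eq_rder (rder_eq _ _ _ _ _ (rderM _ _ _ _ _ er ec)).
    by move=> y; rewrite Re_cexp.
  by rewrite ReM Re_cexp Im_cexp; ring.
apply: eq_rder (rder_eq _ _ _ _ _ (rderM _ _ _ _ _ er es)).
  by move=> y; rewrite Im_cexp.
by rewrite ImM Re_cexp Im_cexp; ring.
Qed.

Lemma cder_cpow (h : R -> R) z x (c : R) : 0 < h x -> rder h x c ->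
  cder (fun y => cpow (h y) z) x (z * (c / h x)%:C * cpow (h x) z).
Proof.
move=> h0 hc; apply: cder_cexp.
apply: cder_eq (cderM _ _ _ _ _ (cder_cst z x)
  (cder_real _ _ _ (rder_comp _ _ _ _ _ (is_derive1_ln h0) hc))).
by rewrite mul0r add0r (mulrC _ c).
Qed.

Lemma cder0_eq f x y : (forall t, cder f t 0) -> f x = f y.
Proof.
move=> f0; apply: complex_ext.
  by apply: (@is_derive_0_is_cst _ (fun t => Re (f t))) => t; have [] := f0 t.
by apply: (@is_derive_0_is_cst _ (fun t => Im (f t))) => t; have [] := f0 t.
Qed.

Lemma cder_cmeas f : (forall x, exists a, cder f x a) -> cmeas f.
Proof.
move=> df; split; apply: continuous_measurable_fun => x.
  by have [a [fa _]] := df x; exact: rder_continuous fa.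
by have [a [_ fa]] := df x; exact: rder_continuous fa.
Qed.
End complex_derivatives.

(** * The fundamental theorem of calculus on the open half-line *)

Section half_line_integrals.
Context {R : realType}.
Local Notation mu := (@lebesgue_measure R).
Local Notation D := (`]0, +oo[%classic : set R).
Implicit Types (P p : R -> R).

Lemma Rintegral_segment P p (a b : R) : 0 < a -> a < b ->
  (forall x, 0 < x -> rder P x (p x)) ->
  (forall x, 0 < x -> {for x, continuous p}) ->
  mu.-integrable `[a, b] (EFin \o p) /\
  (\int[mu]_(x in `[a, b]) (p x)%:E = (P b - P a)%:E)%E.
Proof.
move=> a0 ab dP cp.
have pos x : x \in `[a, b]%R -> 0 < x.
  by rewrite in_itv /= => /andP[ax _]; exact: lt_le_trans ax.
have cp' : {within `[a, b], continuous p}.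
  by apply: continuous_in_subspaceT => x; rewrite inE => /pos; exact: cp.
split.
  by apply: continuous_compact_integrable => //; exact: segment_compact.
rewrite (@continuous_FTC2 _ p P)//.
- split.
  + move=> x xab; have [] // := dP x.
    by apply: pos; exact: subset_itv_oo_cc.
  + apply: cvg_at_right_filter; apply: rder_continuous (dP a a0).
  + by apply: cvg_at_left_filter; apply: rder_continuous (dP b (lt_trans a0 ab)).
- move=> x xab; rewrite derive1E; apply: derive_val.
  by apply: dP; apply: pos; exact: subset_itv_oo_cc.
Qed.

(** An exhaustion symmetric in ln x: both ends of the half-line are approached at a geometric rate,
    so boundary terms become geometric sequences. *)
Definition window n : set R := `[expR (- n%:R), expR n%:R].

Lemma measurable_window n : measurable (window n : set (measurableTypeR R)).
Proof. exact: measurable_itv. Qed.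

Lemma window_gt0 n x : window n x -> 0 < x.
Proof.
by rewrite /window /= in_itv /= => /andP[nx _]; rewrite (lt_le_trans _ nx)// expR_gt0.
Qed.

Lemma in_window x : 0 < x -> \forall n \near \oo, window n x.
Proof.
move=> x0; near=> n; rewrite /window /= in_itv /= -{1 2}(lnK (x := x))// !ler_expR.
rewrite -ler_norml; near: n; exact: nbhs_infty_ger.
Unshelve. all: by end_near. Qed.

Lemma window_nondecreasing : nondecreasing_seq window.
Proof.
move=> m n mn; apply/subsetPset => x; rewrite /window /= !in_itv /= => /andP[h1 h2].
by rewrite (le_trans _ h1) ?(le_trans h2)// ler_expR ?lerN2 ler_nat.
Qed.

Lemma bigcup_window : \bigcup_n window n = D.
Proof.
apply/seteqP; split=> x; first by move=> [n _ /window_gt0]; rewrite /= in_itv /= andbT.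
by move=> /half_line_gt0 /in_window [n _ /(_ n (leqnn n))]; exists n.
Qed.

Lemma Rintegral_window P p n :
  (forall x, 0 < x -> rder P x (p x)) ->
  (forall x, 0 < x -> {for x, continuous p}) ->
  (\int[mu]_(x in window n) (p x)%:E = (P (expR n%:R) - P (expR (- n%:R)))%:E)%E.
Proof.
(* For n = 0 the window is the single point 1, which the strict inequality in [Rintegral_segment]
   excludes. *)
move=> dP cp; case: n => [|n].
  by rewrite /window oppr0 subrr set_itv1 integral_set1.
apply: (Rintegral_segment _ _ _ _ _ _ dP cp).2; first exact: expR_gt0.
by rewrite ltr_expR gtrN.
Qed.

(** The integral over a window is an increment of [P], hence at most [C]; monotone convergence along
    the windows then bounds the whole integral. *)
Lemma bounded_antiderivative_integrable P p (C : R) :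
  (forall x, 0 < x -> rder P x (p x)) ->
  (forall x, 0 < x -> {for x, continuous p}) ->
  measurable_fun setT p -> (forall x, 0 < x -> 0 <= p x) ->
  (forall x, 0 < x -> 0 <= P x <= C) ->
  mu.-integrable D (EFin \o p).
Proof.
move=> dP cp mp p0 PC; apply/integrableP; split.
  by apply/measurable_EFinP; apply: measurable_funS mp.
rewrite (_ : (\int[_]_(x in _) _)%E = (\int[mu]_(x in D) (p x)%:E)%E); last first.
  by apply: eq_integral => x; rewrite inE => /half_line_gt0 x0; rewrite /= ger0_norm// p0.
rewrite -bigcup_window.
apply: (@le_lt_trans _ _ C%:E); last exact: ltry.
have mp' n : measurable_fun (window n) (EFin \o p).
  by apply/measurable_EFinP; apply: measurable_funS mp.
have h := @ge0_nondecreasing_set_cvg_integral _ (measurableTypeR R) R window (EFin \o p) mu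
  window_nondecreasing measurable_window mp'.
rewrite -(cvg_lim _ (h _))//; last first.
  by move=> n x /window_gt0 x0; rewrite lee_fin p0.
apply: lime_le.
  by apply/cvg_ex; eexists; apply: h => n x /window_gt0 x0; rewrite lee_fin p0.
apply: nearW => n; rewrite (Rintegral_window _ _ _ dP cp) lee_fin.
have /andP[_ h1] := PC _ (expR_gt0 n%:R).
by have /andP[h2 _] := PC _ (expR_gt0 (- n%:R)); lra.
Qed.

(** This is integration by parts without boundary terms: dominated convergence, with [|p|] as bound,
    carries the increments of [P] over windows to the half-line. *)
Lemma Rintegral_total_derivative P p :
  (forall x, 0 < x -> rder P x (p x)) ->
  (forall x, 0 < x -> {for x, continuous p}) ->
  measurable_fun setT p -> mu.-integrable D (EFin \o p) ->
  (fun n => P (expR n%:R)) @ \oo --> (0 : R) ->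
  (fun n => P (expR (- n%:R))) @ \oo --> (0 : R) ->
  \int[mu]_(x in D) p x = 0.
Proof.
move=> dP cp mp ip Py P0.
have [] := @Rintegral_dominated_cvg _ (fun n => p \_ (window n)) p (fun x => `|p x|).
- move=> n; apply/(measurable_restrictT p); first exact: measurable_window.
  exact: measurable_funS mp.
- exact: (integrable_abse ip).
- by move=> n x x0; rewrite patchE; case: ifP => // _; rewrite normr0.
- move=> x /in_window xn; apply: cvg_near_cst; apply: filterS xn => n xn.
  by rewrite patchE mem_set.
move=> _ h; rewrite -(cvg_lim _ h)//; apply: cvg_lim => //.
rewrite (_ : (fun n => _) = fun n => P (expR n%:R) - P (expR (- n%:R))).
  by rewrite -[0 in X in _ --> X](subrr (0 : R)); exact: cvgB.
apply/funext => n; rewrite -Rintegral_mkcondr (setIidr _); last first.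
  by move=> x /window_gt0 /=; rewrite in_itv /= andbT.
by rewrite /Rintegral (Rintegral_window _ _ _ dP cp).
Qed.
End half_line_integrals.

(** * The majorants y^p e^(- q y) *)

Section gamma_integrands.
Context {R : realType}.
Local Notation mu := (@lebesgue_measure R).
Local Notation D := (`]0, +oo[%classic : set R).
Implicit Types (p q y : R).

(** Apply ln x < x at x = (q / p)(1 + y) and multiply by p: the constant collects the terms free of
    y. *)
Lemma expRN_le p q : 0 < p -> 0 < q ->
  exists2 C, 0 < C & forall y, 0 < y -> expR (- (q * y)) <= C * expR (- (p * ln (1 + y))).
Proof.
move=> p0 q0; have r0 : 0 < q / p by rewrite divr_gt0.
exists (expR (q - p * ln (q / p))) => [|y y0]; first exact: expR_gt0.
rewrite -expRD ler_expR.
have y1 : 0 < 1 + y by rewrite addr_gt0.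
have : ln (q / p * (1 + y)) < q / p * (1 + y) by rewrite ln_sublinear// mulr_gt0.
rewrite lnM ?posrE// => /ltW; rewrite -(ler_pM2l p0) mulrDr mulrA.
rewrite (mulrC p (q / p)) divfK ?gt_eqF// => h.
by lra.
Qed.

(* y^p e^(- q y) for y > 0. *)
Definition pexp p q y := expR (p * ln y - q * y).

Lemma pexp_ge0 p q y : 0 <= pexp p q y. Proof. exact: expR_ge0. Qed.

Lemma measurable_pexp p q : measurable_fun setT (pexp p q).
Proof.
apply: (measurableT_comp (f := @expR R)) => //; apply: measurable_funB.
  by apply: measurable_funM => //; exact: measurable_cst.
by apply: measurable_funM => //; exact: measurable_cst.
Qed.

(* The integrand is at most a constant times the derivative of the bounded
   function (y / (1 + y))^p. *)
Lemma pexp_integrable p q : 0 < p -> 0 < q ->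
  mu.-integrable D (EFin \o pexp (p - 1) q).
Proof.
move=> p0 q0.
pose P y := expR (p * (ln y - ln (1 + y))).
pose r y := p * expR ((p - 1) * ln y - (p + 1) * ln (1 + y)).
have dr x : 0 < x -> rder (fun y => ln (1 + y)) x (1 + x)^-1.
  move=> x0; have x1 : 0 < 1 + x by rewrite addr_gt0.
  apply: rder_eq (rder_comp _ _ _ _ _ (is_derive1_ln x1)
    (rderD _ _ _ _ _ (rder_cst 1 x) (rder_id x))).
  by rewrite add0r mulr1.
have ir : mu.-integrable D (EFin \o r).
  apply: (@bounded_antiderivative_integrable _ P r 1).
  - move=> x x0; have x1 : 0 < 1 + x by rewrite addr_gt0.
    apply: rder_eq (rder_comp _ _ _ _ _ (is_derive_expR _)
      (rderM _ _ _ _ _ (rder_cst p x) (rderB _ _ _ _ _ (is_derive1_ln x0) (dr x x0)))).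
    rewrite mul0r add0r /r.
    have -> : (p - 1) * ln x - (p + 1) * ln (1 + x) =
       p * (ln x - ln (1 + x)) + (- ln x) + (- ln (1 + x)) by ring.
    rewrite !expRD !expRN !lnK ?posrE//.
    by field; rewrite !gt_eqF.
  - move=> x x0; apply: (@rder_continuous _ _ _ _).
    apply: rderM (rder_cst _ _) _; apply: rder_comp (is_derive_expR _) _.
    apply: rderB; apply: rderM (rder_cst _ _) _; [exact: is_derive1_ln|exact: dr].
  - apply: measurable_funM; first exact: measurable_cst.
    apply: (measurableT_comp (f := @expR R)) => //; apply: measurable_funB.
      by apply: measurable_funM => //; exact: measurable_cst.
    apply: measurable_funM; first exact: measurable_cst.
    apply: (measurableT_comp (f := @ln R)) => //.
    by apply: measurable_funD => //; exact: measurable_cst.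
  - by move=> x x0; rewrite mulr_ge0 ?expR_ge0// ltW.
  - move=> x x0; have x1 : 0 < 1 + x by rewrite addr_gt0.
    apply/andP; split; first exact: expR_ge0.
    by rewrite /P expR_le1 pmulr_rle0// subr_le0 ler_ln ?posrE// lerDr.
have p10 : 0 < p + 1 by rewrite addr_gt0.
have [C C0 hC] := expRN_le _ _ p10 q0.
apply: dominated_Rintegrable (RintegrableZ _ (C / p) ir) _.
  exact: measurable_pexp.
move=> x x0; rewrite ger0_norm ?pexp_ge0// /pexp /r mulrA divfK ?gt_eqF//.
by rewrite !expRD mulrCA ler_pM2l ?expR_gt0// hC.
Qed.

Lemma geometric_squeeze (u : nat -> R) (C r : R) : 0 < r ->
  (forall n, `|u n| <= C * expR (- (r * n%:R))) -> u @ \oo --> (0 : R).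
Proof.
move=> r0 uC; apply: norm_cvg0.
apply: (@squeeze_cvgr _ _ _ _ (cst 0) (fun n => C * expR (- r) ^+ n)).
- by apply: nearW => n; rewrite normr_ge0 /= (le_trans (uC n))// -expRM_natl mulrN (mulrC r).
- exact: cvg_cst.
- rewrite -[0 in X in _ --> X](mulr0 C); apply: cvgMr.
  by apply: cvg_expr; rewrite ger0_norm ?expR_ge0// expR_lt1 oppr_lt0.
Qed.

(** At y = e^n, [expRN_le] with exponent p + 1 beats y^p by one power and leaves C e^(- n); at y =
    e^(- n) the factor y^p = e^(- p n) suffices. *)
Lemma pexp_vanishes p q (u : R -> R) : 0 < p -> 0 < q ->
  (forall y, 0 < y -> `|u y| <= pexp p q y) ->
  (fun n => u (expR n%:R)) @ \oo --> (0 : R) /\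
  (fun n => u (expR (- n%:R))) @ \oo --> (0 : R).
Proof.
move=> p0 q0 uw; split.
  have p10 : 0 < p + 1 by rewrite addr_gt0.
  have [C C0 hC] := expRN_le _ _ p10 q0.
  apply: (@geometric_squeeze _ C 1) => // n; rewrite (le_trans (uw _ (expR_gt0 _)))//.
  rewrite /pexp expRD expRK (le_trans (ler_wpM2l _ (hC _ (expR_gt0 _)))) ?expR_ge0//.
  rewrite mulrCA ler_pM2l// -expRD ler_expR.
  have : n%:R <= ln (1 + expR n%:R) :> R.
    by rewrite -[leLHS]expRK ler_ln ?posrE ?addr_gt0 ?expR_gt0// lerDr.
  by rewrite -(ler_pM2l p10) => h; lra.
apply: (@geometric_squeeze _ 1 p) => // n; rewrite (le_trans (uw _ (expR_gt0 _)))//.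
rewrite mul1r /pexp ler_expR expRK mulrN -subr_ge0 opprB addrC subrK.
by rewrite mulr_ge0 ?expR_ge0// ltW.
Qed.
End gamma_integrands.

(** * The function 0F1: derivative, contiguous relation and the bound by 1 *)

Section hypergeometric.
Context {R : realType}.
Implicit Types (nu z : R[i]) (x : R) (c : nat -> R).

Definition poch z m : R[i] := \prod_(i < m) (z + i%:R).

Lemma pochS z m : poch z m.+1 = poch z m * (z + m%:R).
Proof. by rewrite /poch big_ord_recr. Qed.

Lemma pochSl z m : poch z m.+1 = z * poch (z + 1) m.
Proof.
rewrite /poch big_ord_recl addr0; congr (_ * _); apply: eq_bigr => i _.
by rewrite /bump /= -addrA natrD.
Qed.

Definition hyp0F1_coef nu m : R[i] := (-1) ^+ m / (m`!%:R * poch (nu + 1) m).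

(* The power series 0F1(; nu + 1; - x). *)
Definition hyp0F1 nu x : R[i] :=
  limn (pseries (fun m => Re (hyp0F1_coef nu m)) x) +i*
  limn (pseries (fun m => Im (hyp0F1_coef nu m)) x).

Lemma Re_le_normc z : Re z <= normc z.
Proof. exact: le_trans (ler_norm _) (normr_Re_le z). Qed.

Lemma normc_nat n : normc (n%:R : R[i]) = n%:R.
Proof. by rewrite -(rmorph_nat (real_complex R)) normc_real normr_nat. Qed.

Lemma le_normc_shift nu i : 0 <= Re nu -> i.+1%:R <= normc (nu + 1 + i%:R).
Proof.
move=> nu0; rewrite (le_trans _ (Re_le_normc _))// !ReD Re_nat /= -natr1.
by lra.
Qed.

Lemma shift_neq0 nu i : 0 <= Re nu -> nu + 1 + i%:R != 0.
Proof.
move=> nu0; apply/eqP => n0; have := le_normc_shift nu i nu0.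
by rewrite n0 normc_real normr0 leNgt ltr0n.
Qed.

Lemma succ_neq0 nu : 0 <= Re nu -> nu + 1 != 0.
Proof. by move=> /(shift_neq0 _ 0); rewrite addr0. Qed.

Lemma poch_neq0 nu m : 0 <= Re nu -> poch (nu + 1) m != 0.
Proof. by move=> nu0; apply/prodf_neq0 => i _; exact: shift_neq0. Qed.

Lemma normcX z n : normc (z ^+ n) = normc z ^+ n.
Proof.
elim: n => [|n ih]; first by rewrite !expr0 normc_real normr1.
by rewrite !exprS normcM ih.
Qed.

Lemma normc_poch_ge1 nu m : 0 <= Re nu -> 1 <= normc (poch (nu + 1) m).
Proof.
move=> nu0; elim: m => [|m ih]; first by rewrite /poch big_ord0 normc_real normr1.
rewrite pochS normcM -[1]mulr1 ler_pM//.
by rewrite (le_trans _ (le_normc_shift _ _ nu0))// ler1n.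
Qed.

Lemma normc_hyp0F1_coef_le nu m : 0 <= Re nu ->
  normc (hyp0F1_coef nu m) <= m`!%:R^-1.
Proof.
move=> nu0; rewrite normcM normcX normcN normc_real normr1 expr1n mul1r normcV.
rewrite normcM normc_nat invfM ler_piMr ?invr_ge0// invf_le1 ?normc_poch_ge1//.
exact: lt_le_trans (normc_poch_ge1 _ _ nu0).
Qed.

Lemma is_cvg_pseries_fact c x : (forall m, `|c m| <= m`!%:R^-1) -> cvgn (pseries c x).
Proof.
move=> cm; apply: normed_cvg.
apply: (@series_le_cvg _ _ (fun m => `|x| ^+ m / m`!%:R)).
- by move=> m; rewrite normr_ge0.
- by move=> m; rewrite divr_ge0// exprn_ge0.
- by move=> m; rewrite /= normrM normrX mulrC ler_wpM2l// exprn_ge0.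
- exact: is_cvg_series_exp_coeff.
Qed.

(** Since (m + 1) / (m + 1)! = 1 / m!, the bound survives formal differentiation. Termwise
    differentiation asks for convergence of the first two formal derivatives as well, and this
    supplies it everywhere. *)
Lemma pseries_diffs_fact_le c m : (forall m, `|c m| <= m`!%:R^-1) ->
  `|pseries_diffs c m| <= m`!%:R^-1.
Proof.
move=> cm; rewrite normrM normr_nat (le_trans (ler_wpM2l _ (cm m.+1)))//.
by rewrite factS natrM invfM mulVKf ?pnatr_eq0.
Qed.

Lemma rder_pseries_fact c x : (forall m, `|c m| <= m`!%:R^-1) ->
  rder (fun y => limn (pseries c y)) x (limn (pseries (pseries_diffs c) x)).
Proof.
move=> cm.
have c1 m : `|pseries_diffs c m| <= m`!%:R^-1 by exact: pseries_diffs_fact_le.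
have c2 m : `|pseries_diffs (pseries_diffs c) m| <= m`!%:R^-1.
  exact: pseries_diffs_fact_le.
apply: (@pseries_snd_diffs _ c (`|x| + 1)); [exact: is_cvg_pseries_fact..|].
by rewrite [ltRHS]ger0_norm ?addr_ge0// ltrDl.
Qed.

Lemma hyp0F1_coef_re nu m : 0 <= Re nu -> `|Re (hyp0F1_coef nu m)| <= m`!%:R^-1.
Proof. by move=> nu0; rewrite (le_trans (normr_Re_le _))// normc_hyp0F1_coef_le. Qed.
Lemma hyp0F1_coef_im nu m : 0 <= Re nu -> `|Im (hyp0F1_coef nu m)| <= m`!%:R^-1.
Proof. by move=> nu0; rewrite (le_trans (normr_Im_le _))// normc_hyp0F1_coef_le. Qed.

Lemma ccvg_hyp0F1 nu x : 0 <= Re nu ->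
  ccvg (fun N => \sum_(0 <= m < N) hyp0F1_coef nu m * x%:C ^+ m) (hyp0F1 nu x).
Proof.
move=> nu0.
have cr := is_cvg_pseries_fact _ x (fun m => hyp0F1_coef_re nu m nu0).
have ci := is_cvg_pseries_fact _ x (fun m => hyp0F1_coef_im nu m nu0).
split.
  rewrite (_ : (fun N => _) = pseries (fun m => Re (hyp0F1_coef nu m)) x)//.
  apply/funext => N; rewrite Re_sum; apply: eq_bigr => m _.
  by rewrite -rmorphXn ReM /= mulr0 subr0.
rewrite (_ : (fun N => _) = pseries (fun m => Im (hyp0F1_coef nu m)) x)//.
apply/funext => N; rewrite Im_sum; apply: eq_bigr => m _.
by rewrite -rmorphXn ImM /= mulr0 add0r.
Qed.

Lemma hyp0F1_coef_diffs nu m : 0 <= Re nu ->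
  m.+1%:R * hyp0F1_coef nu m.+1 = - (nu + 1)^-1 * hyp0F1_coef (nu + 1) m.
Proof.
move=> nu0; rewrite /hyp0F1_coef pochSl factS natrM exprS.
have h1 := succ_neq0 _ nu0.
have h2 : poch (nu + 1 + 1) m != 0.
  by apply: poch_neq0; rewrite ReD /= addr_ge0.
have h3 : m.+1%:R != 0 :> R[i] by rewrite pnatr_eq0.
have h4 : m`!%:R != 0 :> R[i] by rewrite pnatr_eq0 -lt0n fact_gt0.
move: (m.+1%:R : R[i]) (m`!%:R : R[i]) h3 h4 => M F h3 h4.
by field; rewrite h1 h2 h3 h4.
Qed.

Lemma cder_hyp0F1 nu x : 0 <= Re nu ->
  cder (hyp0F1 nu) x (- (nu + 1)^-1 * hyp0F1 (nu + 1) x).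
Proof.
move=> nu0.
have nu1 : 0 <= Re (nu + 1) by rewrite ReD /= addr_ge0.
have [cr ci] := ccvgMl (- (nu + 1)^-1) _ _ (ccvg_hyp0F1 _ x nu1).
split.
  apply: rder_eq (rder_pseries_fact _ x (fun m => hyp0F1_coef_re nu m nu0)).
  rewrite -(cvg_lim _ cr)//; congr (limn _); apply/funext => N.
  rewrite mulr_sumr Re_sum; apply: eq_bigr => m _.
  rewrite mulrA -hyp0F1_coef_diffs// -rmorphXn ReM /= mulr0 subr0 /pseries_diffs.
  by rewrite [in RHS]ReM Re_nat Im_nat mul0r subr0.
apply: rder_eq (rder_pseries_fact _ x (fun m => hyp0F1_coef_im nu m nu0)).
rewrite -(cvg_lim _ ci)//; congr (limn _); apply/funext => N.
rewrite mulr_sumr Im_sum; apply: eq_bigr => m _.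
rewrite mulrA -hyp0F1_coef_diffs// -rmorphXn ImM /= mulr0 add0r /pseries_diffs.
by rewrite [in RHS]ImM Re_nat Im_nat mul0r addr0.
Qed.

(** Over a common denominator this is nu + 2 + m = (nu + 1) + (m + 1), where m + 1 cancels against
    (m + 1)!. *)
Lemma hyp0F1_coef_contiguous nu m : 0 <= Re nu ->
  hyp0F1_coef nu m.+1 =
  hyp0F1_coef (nu + 1) m.+1 - ((nu + 1) * (nu + 2))^-1 * hyp0F1_coef (nu + 2) m.
Proof.
move=> nu0; rewrite /hyp0F1_coef.
have h1 := succ_neq0 _ nu0.
have e2 : nu + 2 = nu + 1 + 1 by rewrite -addrA.
have h2 : nu + 2 != 0 by rewrite e2 succ_neq0// ReD /= addr_ge0.
have h5 : nu + 2 + m%:R != 0.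
  by rewrite e2 shift_neq0// ReD /= addr_ge0.
have h3 : poch (nu + 2 + 1) m != 0.
  by apply: poch_neq0; rewrite ReD Re_nat addr_ge0.
have h4 : poch (nu + 2) m != 0.
  by rewrite e2; apply: poch_neq0; rewrite ReD /= addr_ge0.
have hp : (nu + 2) * poch (nu + 2 + 1) m = poch (nu + 2) m * (nu + 2 + m%:R).
  by rewrite -pochSl pochS.
have -> : poch (nu + 1) m.+1 = (nu + 1) * poch (nu + 2) m by rewrite pochSl e2.
have -> : poch (nu + 1 + 1) m.+1 = poch (nu + 2) m * (nu + 2 + m%:R) by rewrite -e2 pochS.
have -> : poch (nu + 2 + 1) m = poch (nu + 2) m * (nu + 2 + m%:R) / (nu + 2).
  by rewrite -hp mulrC mulKf.
have h6 : m.+1%:R != 0 :> R[i] by rewrite pnatr_eq0.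
have h7 : m`!%:R != 0 :> R[i] by rewrite pnatr_eq0 -lt0n fact_gt0.
rewrite factS natrM exprS -natr1; rewrite -natr1 in h6.
by field; rewrite h1 h2 h4 h5 h6 h7.
Qed.

(** Through [cder_hyp0F1] this is the equation x h'' + (nu + 1) h' + h = 0, written with shifted
    orders in place of derivatives. *)
Lemma hyp0F1_contiguous nu x : 0 <= Re nu ->
  hyp0F1 nu x = hyp0F1 (nu + 1) x -
    x%:C * ((nu + 1) * (nu + 2))^-1 * hyp0F1 (nu + 2) x.
Proof.
move=> nu0.
have nu1 : 0 <= Re (nu + 1) by rewrite ReD /= addr_ge0.
have nu2 : 0 <= Re (nu + 2) by rewrite ReD Re_nat addr_ge0.
have := ccvg_hyp0F1 _ x nu0; move/ccvg_unique; apply.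
set k := x%:C * _.
have c1 := ccvg_hyp0F1 _ x nu1.
have c2 := ccvgMl (- k) _ _ (ccvg_hyp0F1 _ x nu2).
have shift (u : nat -> R[i]) l : ccvg (fun n => u n.+1) l -> ccvg u l.
  by move=> [? ?]; split; rewrite -cvg_shiftS.
have unshift (u : nat -> R[i]) l : ccvg u l -> ccvg (fun n => u n.+1) l.
  by move=> [h1 h2]; split; [rewrite -cvg_shiftS in h1|rewrite -cvg_shiftS in h2].
(* The factor x raises the degree by one, so N + 1 terms of the series of orders nu and nu + 1 match
   N terms of the series of order nu + 2. *)
apply: shift; rewrite -mulNr.
apply: eq_ccvg (ccvgD _ _ _ _ (unshift _ _ c1) c2) => N.
rewrite !big_nat_recl// mulr_sumr -addrA -big_split /=; congr (_ + _).
  by rewrite /hyp0F1_coef /poch !big_ord0.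
apply: eq_bigr => m _; rewrite (hyp0F1_coef_contiguous nu m nu0).
by rewrite exprS /k; ring.
Qed.

Lemma hyp0F1_at0 nu : 0 <= Re nu -> hyp0F1 nu 0 = 1.
Proof.
move=> nu0; apply: ccvg_unique (ccvg_hyp0F1 _ 0 nu0) _.
have e N : \sum_(0 <= m < N.+1) hyp0F1_coef nu m * 0%:C ^+ m = 1.
  rewrite big_nat_recl// expr0 mulr1 big1 ?addr0.
    by rewrite /hyp0F1_coef /poch big_ord0 expr0 fact0 mulr1 divff// oner_neq0.
  by move=> i _; rewrite exprS mul0r mulr0.
split; rewrite -cvg_shiftS.
  by under eq_fun do rewrite e; exact: cvg_cst.
by under eq_fun do rewrite e; exact: cvg_cst.
Qed.

(* With h = hyp0F1 nu, the energy |h|^2 + x |h'|^2 is nonincreasing for x >= 0: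
   the equation x h'' + (nu + 1) h' + h = 0 makes its derivative equal to
   (1 - 2 Re (nu + 1)) |h'|^2. *)
Lemma normc_hyp0F1_le1 nu x : 0 <= Re nu -> 0 <= x -> normc (hyp0F1 nu x) <= 1.
Proof.
move=> nu0 x0.
have nu1 : 0 <= Re (nu + 1) by rewrite ReD /= addr_ge0.
have n1 := succ_neq0 _ nu0.
have n2 : nu + 2 != 0 by rewrite -[2]/(1 + 1) addrA succ_neq0.
pose h1 y := - (nu + 1)^-1 * hyp0F1 (nu + 1) y.
pose h2 y := ((nu + 1) * (nu + 2))^-1 * hyp0F1 (nu + 2) y.
have dh y : cder (hyp0F1 nu) y (h1 y) by exact: cder_hyp0F1.
have dh1 y : cder h1 y (h2 y).
  apply: cder_eq (cderM _ _ _ _ _ (cder_cst _ y) (cder_hyp0F1 _ y nu1)).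
  rewrite mul0r add0r /h2 -[nu + 1 + 1]addrA -[1 + 1]/(2 : R[i]).
  by field; rewrite n1 n2.
have ode y : y%:C * h2 y = - ((nu + 1) * h1 y) - hyp0F1 nu y.
  rewrite (hyp0F1_contiguous _ y nu0) /h1 /h2.
  by field; rewrite n1 n2.
pose E y := Re (hyp0F1 nu y) ^+ 2 + Im (hyp0F1 nu y) ^+ 2 +
  y * (Re (h1 y) ^+ 2 + Im (h1 y) ^+ 2).
pose E' y := (1 - 2 * Re (nu + 1)) * (Re (h1 y) ^+ 2 + Im (h1 y) ^+ 2).
have dE y : rder E y (E' y).
  have [dr di] := dh y; have [dr1 di1] := dh1 y.
  have sq (f : R -> R) a : rder f y a -> rder (fun t => f t ^+ 2) y (2 * f y * a).
    by move=> fa; exact: rder_comp (rder_sqr _) fa.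
  apply: rder_eq (rderD _ _ _ _ _ (rderD _ _ _ _ _ (sq _ _ dr) (sq _ _ di))
    (rderM _ _ _ _ _ (rder_id y) (rderD _ _ _ _ _ (sq _ _ dr1) (sq _ _ di1)))).
  have er : y * Re (h2 y) = - Re ((nu + 1) * h1 y) - Re (hyp0F1 nu y).
    by have := congr1 (@complex.Re R) (ode y); rewrite (ReM y%:C (h2 y)) ReD !ReN /= mul0r subr0.
  have ei : y * Im (h2 y) = - Im ((nu + 1) * h1 y) - Im (hyp0F1 nu y).
    by have := congr1 (@complex.Im R) (ode y); rewrite (ImM y%:C (h2 y)) ImD !ImN /= mul0r addr0.
  rewrite mul1r mulrDr [y * (_ * Re (h2 y))]mulrCA [y * (_ * Im (h2 y))]mulrCA er ei.
  by rewrite /E' (ReM (nu + 1) (h1 y)) (ImM (nu + 1) (h1 y)); ring.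
have Ex : E x <= E 0.
  move: x0; rewrite le_eqVlt => /predU1P[<-//|x0].
  have [|c _ hc] := @MVT _ E E' 0 x x0 (fun t _ => dE t).
    by apply: continuous_subspaceT => t; exact: rder_continuous (dE t).
  rewrite -subr_le0 hc subr0 pmulr_lle0// mulr_le0_ge0//.
    by rewrite ReD /=; lra.
  by rewrite addr_ge0// sqr_ge0.
rewrite -(@ler_pXn2r _ 2)// ?nnegrE ?normc_ge0// sqr_normc expr1n.
have : E 0 = 1 by rewrite /E hyp0F1_at0//= mul0r addr0 expr1n expr0n addr0.
move=> E0; rewrite -[leRHS]E0 (le_trans _ Ex)// lerDl mulr_ge0//.
by rewrite addr_ge0// sqr_ge0.
Qed.
End hypergeometric.

(** * The Laplace integral of 0F1: integration by parts, contiguity, differentiation in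
    parameters *)

Section bessel_laplace.
Context {R : realType}.
Local Notation mu := (@lebesgue_measure R).
Local Notation D := (`]0, +oo[%classic : set R).
Implicit Types (nu z s : R[i]) (al b t y : R).

Lemma cpow_addn y z n : 0 < y -> cpow y (z + n%:R) = cpow y z * y%:C ^+ n.
Proof. by move=> y0; rewrite cpowD cpow_natr. Qed.

Lemma cpow_subr1 y z : 0 < y -> cpow y (z - 1) = cpow y z / y%:C.
Proof. by move=> y0; rewrite cpowD cpowN cpow1. Qed.

Lemma real_neq0 y : 0 < y -> y%:C != 0 :> R[i].
Proof. by move=> y0; rewrite fmorph_eq0 gt_eqF. Qed.

Lemma divC y t : (y / t)%:C = y%:C / t%:C :> R[i].
Proof. by rewrite rmorphM fmorphV. Qed.

Lemma Rintegral_of_total_cderivative (P p : R -> R[i]) (r q : R) : 0 < r -> 0 < q ->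
  (forall y, 0 < y -> cder P y (p y)) ->
  (forall y, 0 < y -> exists a, cder p y a) -> cmeas p -> cintegrable p ->
  (forall y, 0 < y -> normc (P y) <= pexp r q y) -> cint p = 0.
Proof.
move=> r0 q0 dP dp [mr mi] [ir ii] hP.
have [] := @pexp_vanishes _ r q (fun y => Re (P y)) r0 q0.
  by move=> y y0; rewrite (le_trans (normr_Re_le _))// hP.
have [] := @pexp_vanishes _ r q (fun y => Im (P y)) r0 q0.
  by move=> y y0; rewrite (le_trans (normr_Im_le _))// hP.
move=> i1 i2 r1 r2; apply: complex_ext => /=.
  apply: (@Rintegral_total_derivative _ (fun y => Re (P y))) => //.
    by move=> y /dP[].
  by move=> y /dp[a [da _]]; exact: rder_continuous da.
apply: (@Rintegral_total_derivative _ (fun y => Im (P y))) => //.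
  by move=> y /dP[].
by move=> y /dp[a [_ da]]; exact: rder_continuous da.
Qed.

(** For z = 2 nu + 1 and b = c^2 / 4 with c > 0 this is, up to a constant, e^(- al y) y^nu J_nu(c
    y). The exponent [z] and the order [nu] stay independent because the identities below shift them
    separately. *)
Definition bint al b z nu y : R[i] :=
  (expR (- (al * y)))%:C * cpow y (z - 1) * hyp0F1 nu (b * y ^+ 2).

Definition bessel_laplace al b z nu : R[i] := cint (bint al b z nu).

Lemma normc_bint al b z nu y : 0 <= Re nu -> 0 <= b -> 0 < y ->
  normc (bint al b z nu y) <= pexp (Re z - 1) al y.
Proof.
move=> nu0 b0 y0; rewrite normcM normcM normc_real normc_cpow ger0_norm ?expR_ge0//.
rewrite ReD ReN /= -expRD addrC ler_piMr ?expR_ge0//.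
by apply: normc_hyp0F1_le1 => //; rewrite mulr_ge0// sqr_ge0.
Qed.

Lemma cmeas_hyp0F1 nu b : 0 <= Re nu -> cmeas (fun y => hyp0F1 nu (b * y ^+ 2)).
Proof.
move=> nu0; apply: cder_cmeas => y; eexists.
apply: cder_comp; first exact: cder_hyp0F1.
exact: rderM (rder_cst _ _) (rder_sqr _).
Qed.

Lemma cmeas_bint al b z nu : 0 <= Re nu -> cmeas (bint al b z nu).
Proof.
move=> nu0; apply: cmeasM (cmeas_hyp0F1 _ _ nu0); apply: cmeasM; last first.
  by apply: cmeas_cpow.
apply: cmeas_real; apply: (measurableT_comp (f := @expR R)) => //.
exact: measurableT_comp.
Qed.

Lemma cintegrable_bint al b z nu : 0 < al -> 0 <= b -> 0 < Re z -> 0 <= Re nu ->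
  cintegrable (bint al b z nu).
Proof.
move=> al0 b0 z0 nu0; apply: (@dominated_cintegrable _ _ (pexp (Re z - 1) al)).
- exact: cmeas_bint.
- exact: pexp_integrable.
- by move=> y y0; exact: normc_bint.
Qed.

Lemma cder_bint al b z nu y : 0 <= Re nu -> 0 < y ->
  cder (bint al b (z + 1) nu) y (- al%:C * bint al b (z + 1) nu y +
    (z * bint al b z nu y + - ((2 * b)%:C / (nu + 1)) * bint al b (z + 2) (nu + 1) y)).
Proof.
move=> nu0 y0; have n1 := succ_neq0 _ nu0.
have yC := real_neq0 _ y0.
have dl : rder (fun t => - (al * t)) y (- al).
  apply: eq_rder (rder_eq _ _ _ _ _ (rderM _ _ _ _ _ (rder_cst (- al) y) (rder_id y))).
    by move=> t; rewrite mulNr.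
  by rewrite mul0r add0r mulr1.
have de := rder_comp _ _ _ _ _ (is_derive_expR _) dl.
have dc := cder_cpow _ z _ _ y0 (rder_id y).
have dh := cder_comp _ _ _ _ _ (cder_hyp0F1 _ _ nu0)
  (rderM _ _ _ _ _ (rder_cst b y) (rder_sqr y)).
apply: eq_cder (cder_eq _ _ _ _ _
  (cderM _ _ _ _ _ (cderM _ _ _ _ _ (cder_real _ _ _ de) dc) dh)).
  by move=> t; rewrite /bint addrK.
rewrite /bint addrK.
have -> : z + 2 - 1 = z + 1%:R by rewrite -addrA; congr (_ + _); rewrite -[2]/(1 + 1) addrK.
rewrite cpow_addn// cpow_subr1// mul0r add0r divC !rmorphM !rmorphN /= rmorph_nat.
by field; rewrite n1 yC.
Qed.

(** The integrand at z + 1 carries y^z, which kills both boundary terms as Re z > 0 and al > 0. So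
    the three terms of its derivative in [cder_bint] integrate to zero. *)
Lemma bessel_laplace_by_parts al b z nu : 0 < al -> 0 <= b -> 0 < Re z -> 0 <= Re nu ->
  al%:C * bessel_laplace al b (z + 1) nu =
  z * bessel_laplace al b z nu
  - (2 * b)%:C / (nu + 1) * bessel_laplace al b (z + 2) (nu + 1).
Proof.
move=> al0 b0 z0 nu0.
have z1 : 0 < Re (z + 1) by rewrite ReD /= addr_gt0.
have z2 : 0 < Re (z + 2) by rewrite ReD Re_nat addr_gt0.
have nu1 : 0 <= Re (nu + 1) by rewrite ReD /= addr_ge0.
have i0 := cintegrable_bint _ _ _ _ al0 b0 z0 nu0.
have i1 := cintegrable_bint _ _ _ _ al0 b0 z1 nu0.
have i2 := cintegrable_bint _ _ _ _ al0 b0 z2 nu1.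
pose p y := - al%:C * bint al b (z + 1) nu y +
    (z * bint al b z nu y + - ((2 * b)%:C / (nu + 1)) * bint al b (z + 2) (nu + 1) y).
have ip : cintegrable p.
  by apply: cintegrableD; [|apply: cintegrableD]; exact: cintegrableMl.
have : cint p = 0.
  apply: (@Rintegral_of_total_cderivative (bint al b (z + 1) nu) p (Re z) al z0 al0 _ _ _ ip).
  - by move=> y y0; exact: cder_bint.
  - move=> y y0; eexists.
    have cM k f a : cder f y a -> cder (fun t => k * f t) y (0 * f y + k * a).
      by move=> fa; exact: cderM (cder_cst _ _) fa.
    have z21 : z + 2 = z + 1 + 1 by rewrite -addrA.
    apply: cderD; [|apply: cderD]; apply: cM.
    + exact: cder_bint.
    (* [cder_bint] is used at z - 1, which is legitimate because it restricts only the order and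
       y. *)
    + by rewrite -[z in bint _ _ z](subrK 1); exact: cder_bint.
    + by rewrite z21; exact: cder_bint.
  - by apply: cmeasD; [|apply: cmeasD]; apply: cmeasM (cmeas_cst _) (cmeas_bint _ _ _ _ _).
  - move=> y y0; rewrite (le_trans (normc_bint _ _ _ _ _ nu0 b0 y0))//.
    by rewrite ReD /= addrK.
rewrite /p cintD; [|exact: cintegrableMl|by apply: cintegrableD; exact: cintegrableMl].
rewrite cintD; [|exact: cintegrableMl..]; rewrite !cintMl// -!/(bessel_laplace _ _ _ _).
by move=> /eqP; rewrite mulNr addrC subr_eq0 => /eqP <-; rewrite mulNr.
Qed.

Lemma bessel_laplace_contiguous al b z nu : 0 < al -> 0 <= b -> 0 < Re z -> 0 <= Re nu ->
  bessel_laplace al b z nu = bessel_laplace al b z (nu + 1)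
  - b%:C / ((nu + 1) * (nu + 2)) * bessel_laplace al b (z + 2) (nu + 2).
Proof.
move=> al0 b0 z0 nu0.
have z2 : 0 < Re (z + 2) by rewrite ReD Re_nat addr_gt0.
have nu1 : 0 <= Re (nu + 1) by rewrite ReD /= addr_ge0.
have nu2 : 0 <= Re (nu + 2) by rewrite ReD Re_nat addr_ge0.
have i1 := cintegrable_bint _ _ _ _ al0 b0 z0 nu1.
have i2 := cintegrable_bint _ _ _ _ al0 b0 z2 nu2.
rewrite -mulNr /bessel_laplace -cintMl// -cintD//; last exact: cintegrableMl.
apply: eq_cint => y y0; rewrite /bint (hyp0F1_contiguous _ _ nu0).
rewrite addrAC cpow_addn// rmorphM rmorphXn /=.
by ring.
Qed.

(** At b = 0 the series is 1, so Gamma belongs to the family and inherits its integration by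
    parts. *)
Lemma cint_cGamma z : cGamma z = bessel_laplace 1 0 z 0.
Proof.
apply: eq_cint => y y0; rewrite /bint mul0r hyp0F1_at0// mulr1 mul1r mulrC.
by [].
Qed.

Lemma cGammaS z : 0 < Re z -> cGamma (z + 1) = z * cGamma z.
Proof.
move=> z0; rewrite !cint_cGamma -[LHS]mul1r (bessel_laplace_by_parts _ _ _ _ ltr01)//.
by rewrite mulr0 !mul0r subr0.
Qed.

(** Differentiation under the integral sign. Domination is asked only near t, since along the
    quadratic path the derivative of the integrand grows with the parameter. *)
Lemma cder_cint (f f' : R -> R -> R[i]) (G : R -> R) (t u v : R) : u < t < v ->
  (forall x, cintegrable (f x)) ->
  (forall x y, 0 < y -> cder (fun x => f x y) x (f' x y)) ->
  mu.-integrable D (EFin \o G) -> (forall y, 0 <= G y) ->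
  (forall x y, u < x < v -> 0 < y -> normc (f' x y) <= G y) ->
  cder (fun x => cint (f x)) t (cint (f' t)).
Proof.
move=> utv fi df iG G0 fG.
have It : (`]u, v[%classic : set R) t by rewrite /= in_itv.
have aux (h h' : R -> R -> R) :
    (forall x, mu.-integrable D (EFin \o h x)) ->
    (forall x y, 0 < y -> rder (fun x => h x y) x (h' x y)) ->
    (forall x y, u < x < v -> 0 < y -> `|h' x y| <= G y) ->
    rder (fun x => \int[mu]_(y in D) h x y) t (\int[mu]_(y in D) h' t y).
  move=> ih dh hG.
  have d1E x y : 0 < y -> partial1of2 h x y = h' x y.
    by move=> y0; rewrite partial1of2E; have [_] := dh x y y0.
  have c1 : forall x y, (`]u, v[%classic : set R) x -> D y -> derivable (h ^~ y) x 1.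
    by move=> x y _ /half_line_gt0 y0; have [] := dh x y y0.
  have c2 : forall x y, (`]u, v[%classic : set R) x -> D y -> `|partial1of2 h x y| <= G y.
    move=> x y xuv /half_line_gt0 y0; rewrite d1E// hG//.
  have c0 : forall x, (`]u, v[%classic : set R) x -> mu.-integrable D (EFin \o h x) by [].
  split; first exact: (derivable_under_integral measurable_half_line It c0 c1 G0 iG c2).
  rewrite -derive1E (differentiation_under_integral measurable_half_line It c0 c1 G0 iG c2).
  by apply: eq_Rintegral => y; rewrite inE => /half_line_gt0 y0; rewrite d1E.
split.
  apply: (aux (fun x y => Re (f x y)) (fun x y => Re (f' x y))).
  - by move=> x; have [] := fi x.
  - by move=> x y y0; have [] := df x y y0.
  - by move=> x y xuv y0; rewrite (le_trans (normr_Re_le _))// fG.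
apply: (aux (fun x y => Im (f x y)) (fun x y => Im (f' x y))).
- by move=> x; have [] := fi x.
- by move=> x y y0; have [] := df x y y0.
- by move=> x y xuv y0; rewrite (le_trans (normr_Im_le _))// fG.
Qed.
End bessel_laplace.

(** * Closed form of the Laplace integral *)

Section bessel_laplace_value.
Context {R : realType}.
Local Notation mu := (@lebesgue_measure R).
Local Notation D := (`]0, +oo[%classic : set R).
Implicit Types (nu z s : R[i]) (al b t y : R).

(** At z = 2 nu + 2 and order nu + 1, integration by parts yields exactly 2 (nu + 1) times the
    right-hand side of the contiguous relation at order nu. This coincidence is what ties the
    exponent to the order. *)
Lemma bessel_laplace_by_parts2 al b nu : 0 < al -> 0 <= b -> 0 <= Re nu ->
  al%:C * bessel_laplace al b (2 * nu + 3) (nu + 1) =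
  2 * (nu + 1) * bessel_laplace al b (2 * nu + 2) nu.
Proof.
move=> al0 b0 nu0.
have nu1 : 0 <= Re (nu + 1) by rewrite ReD /= addr_ge0.
have n1 := succ_neq0 _ nu0.
have n2 : nu + 2 != 0 by rewrite -[2]/(1 + 1) addrA succ_neq0.
have R2 : Re (2 * nu) = 2 * Re nu.
  by rewrite ReM Re_nat Im_nat mul0r subr0.
have z0 : 0 < Re (2 * nu + 2) by rewrite ReD Re_nat R2; lra.
have -> : 2 * nu + 3 = 2 * nu + 2 + 1 by rewrite -addrA natr1.
rewrite bessel_laplace_by_parts// (bessel_laplace_contiguous _ _ (2 * nu + 2) nu)//.
have -> : nu + 1 + 1 = nu + 2 by rewrite -addrA.
rewrite !realE.
move: (bessel_laplace _ _ _ _) (bessel_laplace _ _ _ _) => A B.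
by field; rewrite n1 n2.
Qed.

(* Up to constant factors the integrals at s + 1 and s + 2 are the derivatives
   of the integral at s in al and b, so these two identities say that it
   satisfies the same first-order equations as (al^2 + 4 b)^(- s / 2). *)
Lemma bessel_laplace_ode al b nu s : s = 2 * nu + 1 -> 0 < al -> 0 <= b -> 0 <= Re nu ->
  (al ^+ 2 + 4 * b)%:C * bessel_laplace al b (s + 2) (nu + 1) =
    2 * (nu + 1) * (s * bessel_laplace al b s nu) /\
  2 * (nu + 1) * bessel_laplace al b (s + 1) nu =
    al%:C * bessel_laplace al b (s + 2) (nu + 1).
Proof.
move=> hs al0 b0 nu0; have n1 := succ_neq0 _ nu0.
have s0 : 0 < Re s by rewrite hs ReD ReM Re_nat Im_nat mul0r subr0 /=; lra.
have e1 : 2 * nu + 3 = s + 2 by rewrite hs -addrA (natrD _ 1 2).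
have e2 : 2 * nu + 2 = s + 1 by rewrite hs -addrA.
have h2 := bessel_laplace_by_parts2 _ _ _ al0 b0 nu0.
rewrite e1 e2 in h2; split; last exact: esym h2.
have h1 := bessel_laplace_by_parts _ _ _ _ al0 b0 s0 nu0.
(* One factor [al] is absorbed by [h2], the other by [h1]; the last term produced by [h1] cancels
   the summand with 4 b. *)
rewrite !realE mulrDl expr2 -mulrA h2 mulrCA h1.
rewrite !realE.
move: (bessel_laplace _ _ _ _) (bessel_laplace _ _ _ _) => A B.
by field; rewrite n1.
Qed.

(* The parameters are quadratic in t so that they stay admissible for every real
   t, which makes bessel_laplaceE a statement about a zero derivative on R. *)
Lemma bessel_laplace_path (ka b : R) nu s : s = 2 * nu + 1 -> 0 <= ka -> 0 <= b -> 0 <= Re nu ->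
  forall t, let al := 1 + ka * t ^+ 2 in
  cder (fun t => bessel_laplace (1 + ka * t ^+ 2) (b * t ^+ 2) s nu) t
    (- (2 * ka * t)%:C * bessel_laplace al (b * t ^+ 2) (s + 1) nu
     + - ((2 * b * t)%:C / (nu + 1)) * bessel_laplace al (b * t ^+ 2) (s + 2) (nu + 1)).
Proof.
move=> hs ka0 b0 nu0 t al; have n1 := succ_neq0 _ nu0.
have nu1 : 0 <= Re (nu + 1) by rewrite ReD /= addr_ge0.
have s0 : 0 < Re s by rewrite hs ReD ReM Re_nat Im_nat mul0r subr0 /=; lra.
have s1 : 0 < Re (s + 1) by rewrite ReD /= addr_gt0.
have s2 : 0 < Re (s + 2) by rewrite ReD Re_nat addr_gt0.
have al1 x : 1 <= 1 + ka * x ^+ 2 by rewrite lerDl mulr_ge0// sqr_ge0.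
have al0 x : 0 < 1 + ka * x ^+ 2 by exact: lt_le_trans (al1 x).
have bx0 x : 0 <= b * x ^+ 2 by rewrite mulr_ge0// sqr_ge0.
pose f x y := bint (1 + ka * x ^+ 2) (b * x ^+ 2) s nu y.
pose f' x y := - (2 * ka * x)%:C * bint (1 + ka * x ^+ 2) (b * x ^+ 2) (s + 1) nu y
  + - ((2 * b * x)%:C / (nu + 1)) * bint (1 + ka * x ^+ 2) (b * x ^+ 2) (s + 2) (nu + 1) y.
have i1 := cintegrable_bint _ _ _ _ (al0 t) (bx0 t) s1 nu0.
have i2 := cintegrable_bint _ _ _ _ (al0 t) (bx0 t) s2 nu1.
pose M := `|t| + 1.
have M0 : 0 < M by rewrite ltr_wpDl.
(* On the path al >= 1, so e^(- al y) <= e^(- y); [M] bounds |x| in the factors from the chain rule,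
   and |nu + 1| >= 1 removes the denominator. *)
pose G y := 2 * ka * M * pexp (Re s) 1 y + 2 * b * M * pexp (Re s + 1) 1 y.
have G0 y : 0 <= G y by rewrite addr_ge0// !mulr_ge0 ?pexp_ge0// ltW.
have iG : mu.-integrable D (EFin \o G).
  apply: RintegrableD; apply: RintegrableZ.
    by rewrite -(addrK 1 (Re s)); apply: pexp_integrable => //; rewrite addr_gt0.
  by rewrite -(addrK 1 (Re s + 1)); apply: pexp_integrable => //; rewrite !addr_gt0.
have tM : - M < t < M by rewrite -ltr_norml ltrDl.
have fG x y : - M < x < M -> 0 < y -> normc (f' x y) <= G y.
  move=> xM y0; have xM' : `|x| <= M by rewrite ltW// ltr_norml.
  have pexp1 r : pexp r (1 + ka * x ^+ 2) y <= pexp r 1 y.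
    by rewrite /pexp ler_expR lerD2l lerN2 ler_pM2r.
  rewrite (le_trans (le_normcD _ _))// lerD//.
    rewrite normcM normcN normc_real !normrM normr_nat (ger0_norm ka0).
    apply: ler_pM; rewrite ?normc_ge0 ?mulr_ge0//.
      by rewrite ler_wpM2l// mulr_ge0.
    rewrite (le_trans (normc_bint _ _ _ _ _ nu0 (bx0 x) y0))//.
    by rewrite ReD /= addrK.
  rewrite normcM normcN normcM normc_real !normrM normr_nat (ger0_norm b0).
  apply: ler_pM; rewrite ?normc_ge0 ?mulr_ge0 ?normc_ge0//.
    rewrite normcV -[leRHS]mulr1 ler_pM ?mulr_ge0 ?invr_ge0 ?normc_ge0//.
      by rewrite ler_wpM2l// mulr_ge0.
    have nn : 1 <= normc (nu + 1) by have := le_normc_shift nu 0 nu0; rewrite addr0.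
    by rewrite invf_le1// (lt_le_trans ltr01 nn).
  rewrite (le_trans (normc_bint _ _ _ _ _ nu1 (bx0 x) y0))//.
  by rewrite ReD Re_nat -[2]/(1 + 1) addrA addrK.
have df x y : 0 < y -> cder (fun x => f x y) x (f' x y).
  move=> y0; have yC := real_neq0 _ y0.
  have dl : rder (fun x => - ((1 + ka * x ^+ 2) * y)) x (- (2 * ka * x * y)).
    apply: eq_rder (rder_eq _ _ _ _ _ (rderM _ _ _ _ _ (rderD _ _ _ _ _ (rder_cst 1 x)
      (rderM _ _ _ _ _ (rder_cst ka x) (rder_sqr x))) (rder_cst (- y) x))).
      by move=> u; rewrite mulrN.
    by rewrite mul0r !add0r mulr0 addr0; ring.
  have de := rder_comp _ _ _ _ _ (is_derive_expR _) dl.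
  have dh := cder_comp _ _ _ _ _ (cder_hyp0F1 _ _ nu0)
    (rderM _ _ _ _ _ (rderM _ _ _ _ _ (rder_cst b x) (rder_sqr x)) (rder_cst (y ^+ 2) x)).
  apply: cder_eq (cderM _ _ _ _ _
    (cderM _ _ _ _ _ (cder_real _ _ _ de) (cder_cst (cpow y (s - 1)) x)) dh).
  have -> : f' x y = - (2 * ka * x)%:C * ((expR (- ((1 + ka * x ^+ 2) * y)))%:C *
      (cpow y (s - 1) * y%:C) * hyp0F1 nu (b * x ^+ 2 * y ^+ 2)) +
     - ((2 * b * x)%:C / (nu + 1)) * ((expR (- ((1 + ka * x ^+ 2) * y)))%:C *
      (cpow y (s - 1) * y%:C ^+ 2) * hyp0F1 (nu + 1) (b * x ^+ 2 * y ^+ 2)).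
    rewrite /f' /bint.
    have -> : s + 1 - 1 = s - 1 + 1%:R by rewrite addrAC.
    have -> : s + 2 - 1 = s - 1 + 2%:R by rewrite addrAC.
    by rewrite !cpow_addn// expr1.
  rewrite mulr0 mul0r !addr0 add0r !realE.
  by field.
have := @cder_cint R f f' G t (- M) M tM _ df iG G0 fG.
have -> : cint (f' t) = - (2 * ka * t)%:C * bessel_laplace al (b * t ^+ 2) (s + 1) nu
     + - ((2 * b * t)%:C / (nu + 1)) * bessel_laplace al (b * t ^+ 2) (s + 2) (nu + 1).
  by rewrite /f' cintD ?cintMl//; exact: cintegrableMl.
by apply=> x; exact: cintegrable_bint.
Qed.

(** In product form the derivative along the path involves three integrals, which
    [bessel_laplace_ode] turns into multiples of a single one with total coefficient zero. Writing
    al = 1 + ka with ka >= 0 covers every integer n >= 1. *)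
Lemma bessel_laplaceE (ka b : R) nu s : s = 2 * nu + 1 -> 0 <= ka -> 0 <= b -> 0 <= Re nu ->
  bessel_laplace (1 + ka) b s nu * cpow ((1 + ka) ^+ 2 + 4 * b) (s / 2) = cGamma s.
Proof.
move=> hs ka0 b0 nu0; have n1 := succ_neq0 _ nu0.
have al1 x : 1 <= 1 + ka * x ^+ 2 by rewrite lerDl mulr_ge0// sqr_ge0.
have al0 x : 0 < 1 + ka * x ^+ 2 by exact: lt_le_trans (al1 x).
have bx0 x : 0 <= b * x ^+ 2 by rewrite mulr_ge0// sqr_ge0.
pose d x := (1 + ka * x ^+ 2) ^+ 2 + 4 * (b * x ^+ 2).
have d0 x : 0 < d x by apply: ltr_wpDr; [exact: mulr_ge0|exact: exprn_gt0].
have dd x : rder d x (4 * (1 + ka * x ^+ 2) * (ka * x) + 8 * (b * x)).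
  have dka (k : R) : rder (fun x => k * x ^+ 2) x (2 * k * x).
    apply: rder_eq (rderM _ _ _ _ _ (rder_cst k x) (rder_sqr x)).
    by rewrite mul0r add0r mulrCA mulrA.
  apply: rder_eq (rderD _ _ _ _ _ (rder_comp _ _ _ _ _ (rder_sqr _)
    (rderD _ _ _ _ _ (rder_cst 1 x) (dka ka))) (rderM _ _ _ _ _ (rder_cst 4 x) (dka b))).
  by rewrite add0r mul0r add0r; ring.
pose F x := bessel_laplace (1 + ka * x ^+ 2) (b * x ^+ 2) s nu * cpow (d x) (s / 2).
have F01 : F 0 = F 1.
  apply: cder0_eq => x.
  apply: cder_eq (cderM _ _ _ _ _ (bessel_laplace_path _ _ _ _ hs ka0 b0 nu0 x)
    (cder_cpow _ (s / 2) _ _ (d0 x) (dd x))).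
  have [eqK eqG] := bessel_laplace_ode _ _ _ _ hs (al0 x) (bx0 x) nu0.
  rewrite -/(d x) in eqK eqG.
  have dC := real_neq0 _ (d0 x).
  have two0 : 2 != 0 :> R[i] by rewrite pnatr_eq0.
  have eK : bessel_laplace (1 + ka * x ^+ 2) (b * x ^+ 2) (s + 2) (nu + 1) =
     2 * (nu + 1) * (s * bessel_laplace (1 + ka * x ^+ 2) (b * x ^+ 2) s nu) / (d x)%:C.
    by rewrite -eqK mulrAC divff// mul1r.
  have eG : bessel_laplace (1 + ka * x ^+ 2) (b * x ^+ 2) (s + 1) nu =
     (1 + ka * x ^+ 2)%:C * (s * bessel_laplace (1 + ka * x ^+ 2) (b * x ^+ 2) s nu) / (d x)%:C.
    apply: (mulfI (mulf_neq0 two0 n1)); rewrite eqG eK.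
    by field.
  rewrite eK eG divC; clear eK eG eqK eqG.
  move: (d x) dC => dx dC; move: (bessel_laplace _ _ _ _) => A.
  rewrite !realE.
  by field; rewrite n1 dC.
have := F01; rewrite /F /d expr1n !mulr1 => <-.
rewrite expr0n /= !mulr0 addr0 expr1n addr0 /cpow ln1 mulr0 cexp0 mulr1.
apply: eq_cint => y y0; rewrite /bint mul0r !hyp0F1_at0// mulr1 mul1r mulrC.
by [].
Qed.
End bessel_laplace_value.

(** * Elementary inequalities for trigonometric and hyperbolic functions *)

Section elementary_bounds.
Context {R : realType}.
Implicit Types (x y r : R).

Lemma rder_nondecreasing (f f' : R -> R) x y : (forall t, rder f t (f' t)) ->
  (forall t, 0 <= f' t) -> x <= y -> f x <= f y.
Proof.
move=> df f0; rewrite le_eqVlt => /predU1P[->//|xy].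
have [|c _ hc] := @MVT _ f f' x y xy (fun t _ => df t).
  by apply: continuous_subspaceT => t; exact: rder_continuous (df t).
by rewrite -subr_ge0 hc mulr_ge0// subr_ge0 ltW.
Qed.

Lemma normr_sin_le x : `|sin x| <= `|x|.
Proof.
wlog x0 : x / 0 <= x.
  move=> h; have [/h//|x0] := leP 0 x.
  by rewrite -normrN -sinN -(normrN x) h// oppr_ge0 ltW.
have h1 := @rder_nondecreasing (fun t => t - sin t) (fun t => 1 - cos t) 0 x
  (fun t => rderB _ _ _ _ _ (rder_id t) (is_derive_sin t)).
have h2 := @rder_nondecreasing (fun t => t + sin t) (fun t => 1 + cos t) 0 x
  (fun t => rderD _ _ _ _ _ (rder_id t) (is_derive_sin t)).
rewrite sin0 subr0 in h1; rewrite sin0 addr0 in h2.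
have {}h1 : 0 <= x - sin x by apply: h1 => // t; rewrite subr_ge0 cos_le1.
have {}h2 : 0 <= x + sin x.
  apply: h2 => // t; have := cos_max t; rewrite ler_norml => /andP[h _]; lra.
by rewrite (ger0_norm x0) ler_norml; apply/andP; split; lra.
Qed.

Lemma cos_ge x : 1 - x ^+ 2 / 2 <= cos x.
Proof.
have -> : cos x = 1 - sin (x / 2) ^+ 2 *+ 2.
  rewrite [in LHS](_ : x = x / 2 *+ 2); last by rewrite -mulr_natr divfK// pnatr_eq0.
  rewrite cos_mulr2n cos2sin2.
  by rewrite mulrnBl; lra.
have : sin (x / 2) ^+ 2 <= (x / 2) ^+ 2.
  by rewrite -ler_sqrt ?sqr_ge0// !sqrtr_sqr normr_sin_le.
by rewrite expr_div_n; lra.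
Qed.

(** This is |x| <= |sinh x|, squared to be even in x. For x >= 0 it holds because e^t + e^(- t) - 2
    = (e^t - 1)^2 / e^t is nonnegative. It serves both [sqr_ln_le] and [expRB1_ge]. *)
Lemma sqr_le_expRB x : (x *+ 2) ^+ 2 <= (expR x - expR (- x)) ^+ 2.
Proof.
wlog x0 : x / 0 <= x.
  move=> h; have [/h//|x0] := leP 0 x.
  have := h (- x); rewrite mulNrn sqrrN opprK.
  rewrite (_ : (expR (- x) - expR x) ^+ 2 = (expR x - expR (- x)) ^+ 2); last first.
    by rewrite -sqrrN opprB.
  apply.
  by rewrite oppr_ge0 ltW.
have dN (t : R) : rder (fun t => expR (- t)) t (- expR (- t)).
  apply: rder_eq (rder_comp _ _ _ _ _ (is_derive_expR _) (is_deriveNid _ _)).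
  by rewrite mulrN1.
have d2 t : rder (fun t => t *+ 2) t (2 : R).
  exact: rderD (rder_id t) (rder_id t).
have dS (t : R) : rder (fun t => expR t - expR (- t) - t *+ 2) t (expR t + expR (- t) - 2).
  apply: rder_eq (rderB _ _ _ _ _ (rderB _ _ _ _ _ (is_derive_expR t) (dN t)) (d2 t)).
  by rewrite opprK.
have := rder_nondecreasing _ _ 0 x dS.
rewrite oppr0 expR0 subrr mul0rn subr0 => h.
have {}h : 0 <= expR x - expR (- x) - x *+ 2.
  apply: h => // t; have := expR_gt0 t; set e := expR t => e0.
  rewrite expRN -/e (_ : _ - 2 = (e - 1) ^+ 2 / e) ?divr_ge0 ?sqr_ge0 ?ltW//.
  by field; rewrite gt_eqF.
have x2 : 0 <= x *+ 2 by rewrite mulrn_wge0.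
by rewrite ler_sqr ?nnegrE//; lra.
Qed.

(** The previous inequality at (ln r) / 2. The bound is r - 2 + 1 / r, so against a Gamma integrand
    it only shifts the exponent by one and integrates to Gamma values. *)
Lemma sqr_ln_le r : 0 < r -> ln r ^+ 2 <= (r - 1) ^+ 2 / r.
Proof.
move=> r0; have := sqr_le_expRB (ln r / 2).
rewrite (_ : ln r / 2 *+ 2 = ln r); last by rewrite -mulr_natr divfK// pnatr_eq0.
move=> /le_trans; apply.
rewrite expRN; set e := expR _; have e0 : 0 < e by exact: expR_gt0.
have -> : r = e ^+ 2.
  by rewrite -expRM_natl mulrC divfK ?pnatr_eq0// lnK.
rewrite le_eqVlt; apply/orP; left; apply/eqP.
by field; rewrite gt_eqF.
Qed.

Lemma normc_csin_le (w : R[i]) y : 0 <= y ->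
  normc (csin (w * y%:C)) <= expR (`|Im w| * y).
Proof.
move=> y0; rewrite /csin normcM normcV.
have -> : normc (2 * 'i%C : R[i]) = 2.
  by rewrite normcM normc_nat normcE /= expr0n expr1n add0r sqrtr1 mulr1.
rewrite ler_pdivrMr// (le_trans (le_normcD _ _))// normcN !normc_cexp.
have e : Re ('i%C * (w * y%:C)) = - (Im w * y).
  by rewrite (ReM _ (w * _)) (Im_mul_real w) /= mul0r mul1r sub0r.
have h : `|Im w| * y = `|Im w * y| by rewrite normrM (ger0_norm y0).
rewrite ReN e opprK mulr_natr mulr2n h lerD// ler_expR ?ler_norm//.
by rewrite -normrN ler_norm.
Qed.

(** The linear factor [y] is the point: it cancels the 1 / u of [zeta_weight]. It comes from |sinh
    x| <= |x| e^|x| in the real part and |sin t| <= |t| in the imaginary part. *)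
Lemma normc_csinh_le (w : R[i]) y : 0 <= y ->
  normc (csinh (w * y%:C)) <= (`|Re w| + `|Im w|) * y * expR (`|Re w| * y).
Proof.
move=> y0.
have rE : Re (w * y%:C) = Re w * y by rewrite ReM /= mulr0 subr0.
have iE : Im (w * y%:C) = Im w * y by rewrite ImM /= mulr0 add0r.
set x := Re w * y; set t := Im w * y; rewrite -/x -/t in rE iE.
have ax : `|x| = `|Re w| * y by rewrite normrM (ger0_norm y0).
have at' : `|t| = `|Im w| * y by rewrite normrM (ger0_norm y0).
rewrite -ax 2!mulrDl -ax -at'.
clearbody x t.
have ex : expR x <= expR `|x| by rewrite ler_expR ler_norm.
have ex' : expR (- x) <= expR `|x| by rewrite ler_expR -normrN ler_norm.
have reE : Re (csinh (w * y%:C)) = (expR x - expR (- x)) / 2 * cos t.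
  by rewrite /csinh Re_half ReD ReN !Re_cexp ReN ImN rE iE cosN; ring.
have imE : Im (csinh (w * y%:C)) = (expR x + expR (- x)) / 2 * sin t.
  rewrite /csinh Im_half ImD ImN !Im_cexp ReN ImN rE iE sinN.
  by ring.
rewrite (le_trans (normc_le _))// reE imE !normrM lerD//.
  rewrite -[leRHS]mulr1 ler_pM ?mulr_ge0//; last exact: cos_max.
  rewrite (ger0_norm (x := 2^-1)) ?invr_ge0// ler_pdivrMr//.
  rewrite ler_norml; apply/andP; split.
    (* Multiplied by e^(- x), this tangent bound becomes e^(- x) - e^x <= 2 |x| e^|x| when x < 0;
       the other sign is symmetric. *)
    have : 1 + 2 * x <= expR (2 * x) by exact: expR_ge1Dx.
    move=> h; have [x0|x0] := leP 0 x.
      have : 0 <= `|x| * expR `|x| by rewrite mulr_ge0 ?expR_ge0.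
      have : expR (- x) <= expR x by rewrite ler_expR; lra.
      by lra.
    have -> : `|x| = - x by rewrite ltr0_norm.
    have : expR (- x) * (1 + 2 * x) <= expR (- x) * expR (2 * x) by rewrite ler_pM2l ?expR_gt0.
    rewrite -expRD (_ : - x + 2 * x = x); last by ring.
    by lra.
  have : 1 + 2 * (- x) <= expR (2 * (- x)) by exact: expR_ge1Dx.
  move=> h; have [x0|x0] := leP 0 x; last first.
    have : 0 <= `|x| * expR `|x| by rewrite mulr_ge0 ?expR_ge0.
    have : expR x <= expR (- x) by rewrite ler_expR; lra.
    by lra.
  have -> : `|x| = x by rewrite ger0_norm.
  have : expR x * (1 + 2 * (- x)) <= expR x * expR (2 * (- x)) by rewrite ler_pM2l ?expR_gt0.
  rewrite -expRD (_ : x + 2 * (- x) = - x); last by ring.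
  by lra.
rewrite mulrC ler_pM ?normr_sin_le//.
by rewrite ger0_norm ?addr_ge0 ?expR_ge0// (ger0_norm (x := 2^-1)) ?invr_ge0//; lra.
Qed.
End elementary_bounds.

(** * Gamma has no zero in the right half-plane *)

Section gamma_nonvanishing.
Context {R : realType}.
Local Notation mu := (@lebesgue_measure R).
Local Notation D := (`]0, +oo[%classic : set R).
Implicit Types (x : R) (z : R[i]).

Definition rgamma x : R := \int[mu]_(y in D) pexp (x - 1) 1 y.

Lemma Re_cGamma_real x : Re (cGamma x%:C) = rgamma x.
Proof.
apply: eq_Rintegral => y _; rewrite Re_mul_real Re_cexp Re_mul_real Im_mul_real.
by rewrite ReD ImD /= oppr0 addr0 mul0r cos0 mulr1 /pexp mul1r expRD.
Qed.

Lemma rgammaS x : 0 < x -> rgamma (x + 1) = x * rgamma x.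
Proof.
move=> x0; rewrite -!Re_cGamma_real realD cGammaS ?ReM /= ?mul0r ?subr0//.
Qed.

Lemma rgamma_gt0 x : 0 < x -> 0 < rgamma x.
Proof.
move=> x0; have ig := pexp_integrable _ _ x0 ltr01.
(* A lower bound of the integrand on [1, 2], where 0 <= ln y <= ln 2 and y <= 2. *)
pose c := expR (- (`|x - 1| * ln 2 + 2)).
have c0 : 0 < c by exact: expR_gt0.
rewrite -lte_fin /rgamma /Rintegral fineK; last exact: integrable_fin_num.
apply: (@lt_le_trans _ _ (\int[mu]_(y in `[1%R, 2%R]) (cst c%:E) y)%E).
  rewrite integral_cst//.
  have := @lebesgue_measure_itv R `[1, 2]%R; rewrite /= lte_fin ltr1n /= => ->.
  by rewrite -EFinD -EFinM lte_fin mulr_gt0// subr_gt0 ltr1n.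
have sub : (`[1%R, 2%R]%classic : set R) `<=` D.
  by move=> y; rewrite /= !in_itv /= andbT => /andP[y1 _]; exact: lt_le_trans y1.
have mp : measurable_fun (`]0, +oo[%classic : set (measurableTypeR R))
    (EFin \o pexp (x - 1) 1).
  by have /integrableP[] := ig.
apply: (@le_trans _ _ (\int[mu]_(y in `[1%R, 2%R]) (pexp (x - 1) 1 y)%:E)%E).
  apply: ge0_le_integral => //.
  - by move=> y _; rewrite lee_fin ltW.
  - by apply: measurable_funS mp => //.
  - move=> y; rewrite /= in_itv /= => /andP[y1 y2]; rewrite lee_fin ler_expR.
    have l0 : 0 <= ln y by exact: ln_ge0.
    have l2 : ln y <= ln 2 by rewrite ler_ln ?posrE// (lt_le_trans ltr01 y1).
    have : `|(x - 1) * ln y| <= `|x - 1| * ln 2.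
      by rewrite normrM (ger0_norm l0) ler_wpM2l.
    by rewrite ler_norml => /andP[h _]; lra.
apply: ge0_subset_integral => //.
by move=> y _; rewrite lee_fin pexp_ge0.
Qed.

(* Rotating the phase by M^(- i Im z) at the saddle point M = Re z - 1 and using
   cos t >= 1 - t^2 / 2 leaves Gamma (Re z) (1 - (Im z)^2 / (2 M)) > 0. *)
Lemma cGamma_neq0_large z : 1 + Im z ^+ 2 / 2 < Re z -> cGamma z != 0.
Proof.
set X := Re z; set Y := Im z => XY.
have Y0 : 0 <= Y ^+ 2 by exact: sqr_ge0.
pose M := X - 1; have M0 : 0 < M by rewrite /M; lra.
have X0 : 0 < X by rewrite /M in M0; lra.
have XM : X = M + 1 by rewrite /M subrK.
pose f t := cpow t (z - 1) * (expR (- t))%:C.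
pose k : R[i] := cexp (0 +i* (- (Y * ln M))).
have if_ : cintegrable f.
  apply: (@dominated_cintegrable _ _ (pexp (X - 1) 1)).
  - apply: cmeasM; first by apply: cmeas_cpow.
    by apply: cmeas_real; apply: measurableT_comp.
  - exact: pexp_integrable.
  - move=> t t0; rewrite normcM normc_cpow normc_real ger0_norm ?expR_ge0//.
    by rewrite -expRD /pexp mul1r ReD.
apply/eqP => G0; have Re0 : \int[mu]_(t in D) Re (k * f t) = 0.
  by rewrite -[LHS]/(Re (cint (fun t => k * f t))) cintMl// -/(cGamma z) G0 mulr0.
(* The lower bound 1 - (Y^2 / 2)(t / M - 2 + M / t) of the cosine, times t^(X - 1) e^(- t). Its
   three powers of t integrate to Gamma at X, X + 1 and M = X - 1. *)
pose L t := (1 + Y ^+ 2) * pexp (X - 1) 1 t - (Y ^+ 2 / (2 * M) * pexp (X + 1 - 1) 1 t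
   + Y ^+ 2 * M / 2 * pexp (M - 1) 1 t).
have i1 := pexp_integrable _ _ X0 ltr01.
have i2 := pexp_integrable (X + 1) 1 (addr_gt0 X0 ltr01) ltr01.
have i3 := pexp_integrable _ _ M0 ltr01.
have iR := RintegrableD _ _ (RintegrableZ _ (Y ^+ 2 / (2 * M)) i2)
   (RintegrableZ _ (Y ^+ 2 * M / 2) i3).
have iL : mu.-integrable D (EFin \o L).
  by apply: RintegrableB => //; exact: RintegrableZ.
have intL : \int[mu]_(t in D) L t = rgamma X * (1 - Y ^+ 2 / (2 * M)).
  rewrite RintegralB//; last exact: RintegrableZ.
  rewrite RintegralD//; [|exact: RintegrableZ..].
  rewrite !RintegralZl// -!/(rgamma _) rgammaS// XM rgammaS//.
  by field; rewrite gt_eqF.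
have pos : 0 < \int[mu]_(t in D) L t.
  rewrite intL mulr_gt0 ?rgamma_gt0// subr_gt0 ltr_pdivrMr ?mulr_gt0// mul1r.
  by rewrite /M; lra.
suff : \int[mu]_(t in D) L t <= \int[mu]_(t in D) Re (k * f t) by rewrite Re0 leNgt pos.
have [ikr _] := cintegrableMl k _ if_.
apply: (le_Rintegral measurable_half_line iL ikr).
move=> t /half_line_gt0 t0.
have ReE : Re (k * f t) = pexp (X - 1) 1 t * cos (Y * (ln t - ln M)).
  rewrite /k /f mulrA -cexpD Re_mul_real Re_cexp ReD ImD Re_mul_real Im_mul_real.
  rewrite ReD ImD /= oppr0 addr0 add0r -/X -/Y /pexp expRD mul1r.
  by rewrite mulrAC; congr (_ * cos _); ring.
rewrite ReE.
have -> : L t = pexp (X - 1) 1 t * (1 - Y ^+ 2 / 2 * ((t / M - 1) ^+ 2 / (t / M))).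
  have p1 : pexp (X + 1 - 1) 1 t = pexp (X - 1) 1 t * t.
    rewrite /pexp !expRD -[X in _ = _ * _ * X](lnK (x := t)) ?posrE//.
    by rewrite -!expRD; congr expR; ring.
  have p2 : pexp (M - 1) 1 t = pexp (X - 1) 1 t / t.
    rewrite /pexp !expRD -[X in _ = _ * _ / X](lnK (x := t)) ?posrE// -expRN.
    by rewrite -!expRD XM; congr expR; ring.
  by rewrite /L p1 p2; field; rewrite !gt_eqF.
rewrite ler_wpM2l ?pexp_ge0// (le_trans _ (cos_ge _))// lerD2l lerN2.
rewrite exprMn mulrAC ler_wpM2l ?divr_ge0//.
by rewrite -ln_div ?posrE// sqr_ln_le// divr_gt0.
Qed.

(** A zero at z would propagate by the functional equation to every z + n. The imaginary part stays
    fixed, so for large n this contradicts [cGamma_neq0_large]. *)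
Lemma cGamma_neq0 z : 0 < Re z -> cGamma z != 0.
Proof.
move=> z0; apply/eqP => G0.
have Gn n : cGamma (z + n%:R) = 0.
  elim: n => [|n ih]; first by rewrite addr0.
  by rewrite -natr1 addrA cGammaS ?ih ?mulr0// ReD Re_nat ltr_wpDr.
pose n := Num.trunc (1 + Im z ^+ 2 / 2).
have := @cGamma_neq0_large (z + n.+1%:R); rewrite Gn eqxx => h.
have : false by apply: h; rewrite ReD ImD Re_nat Im_nat addr0 ltr_wpDl ?ltW// truncnS_gt.
by [].
Qed.
End gamma_nonvanishing.

(** * Measurability of integrals depending on a parameter *)

Section parameter_measurability.
Context {R : realType}.
Local Notation mu := (@lebesgue_measure R).
Local Notation D := (`]0, +oo[%classic : set R).
Local Notation RR := (measurableTypeR R * measurableTypeR R)%type.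

(** Tonelli's theorem gives measurability for the positive and the negative part separately; [fine]
    of their difference is measurable even where an inner integral is infinite. *)
Lemma measurable_Rintegral_param (h : RR -> R) : measurable_fun setT h ->
  measurable_fun setT (fun v : R => \int[mu]_(u in D) h (v, u)).
Proof.
move=> mh; pose h1 := h \_ (setT `*` D : set RR).
have mh1 : measurable_fun setT (EFin \o h1).
  apply/measurable_EFinP; apply/(measurable_restrictT h).
    by apply: measurableX => //; exact: measurable_half_line.
  exact: measurable_funS mh.
have hE v : (\int[mu]_(u in D) (h (v, u))%:E = \int[mu]_u (h1 (v, u))%:E)%E.
  rewrite integral_mkcond; apply: eq_integral => u _; rewrite /h1 !patchE.
  have -> : ((v, u) \in (setT `*` D : set RR)) = (u \in D).
    by apply/idP/idP; rewrite !inE => // -[].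
  by case: ifP.
have mp : measurable_fun setT (fun v : R => (\int[mu]_u (EFin \o h1)^\+ (v, u))%E).
  apply: (@measurable_fun_fubini_tonelli_F _ _ (measurableTypeR R) (measurableTypeR R) R
    mu (EFin \o h1)^\+%E) => //.
  exact: measurable_funepos.
have mn : measurable_fun setT (fun v : R => (\int[mu]_u (EFin \o h1)^\- (v, u))%E).
  apply: (@measurable_fun_fubini_tonelli_F _ _ (measurableTypeR R) (measurableTypeR R) R
    mu (EFin \o h1)^\-%E) => //.
  exact: measurable_funeneg.
have -> : (fun v : R => \int[mu]_(u in D) h (v, u)) = fun v =>
    fine (\int[mu]_u (EFin \o h1)^\+ (v, u) - \int[mu]_u (EFin \o h1)^\- (v, u))%E.
  apply/funext => v; rewrite /Rintegral hE [in LHS]integralE.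
  by congr (fine (_ - _)%E); apply: eq_integral => u _; rewrite ?funeposE ?funenegE.
apply: measurableT_comp => //.
exact: emeasurable_funB.
Qed.

Lemma cmeas_cint_param (F : RR -> R[i]) : cmeas F ->
  cmeas (fun v : R => cint (fun u => F (v, u))).
Proof.
move=> [mr mi]; split.
  exact: (@measurable_Rintegral_param (fun z => Re (F z))).
exact: (@measurable_Rintegral_param (fun z => Im (F z))).
Qed.
End parameter_measurability.

(** * Bessel series, summation over n, and bounds for the integrand of [zeta_w] *)

Section bessel_series.
Context {R : realType}.
Local Notation mu := (@lebesgue_measure R).
Local Notation D := (`]0, +oo[%classic : set R).
Implicit Types (nu s w z : R[i]) (c x y u v b : R).

Lemma cGamma_poch z m : 0 < Re z -> cGamma (m%:R + z) = poch z m * cGamma z.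
Proof.
move=> z0; elim: m => [|m ih]; first by rewrite add0r /poch big_ord0 mul1r.
rewrite -natr1 addrAC cGammaS ?ih; last by rewrite ReD Re_nat ltr_wpDl.
by rewrite pochS mulrA (mulrC (m%:R + z)) (addrC m%:R).
Qed.

(** Gamma(m + nu + 1) splits into a rising factorial and Gamma(nu + 1). Only even powers of [c]
    occur, so the formula also covers c <= 0, in particular a = 1. *)
Lemma besselJ_quot_hyp0F1 nu c x : 0 <= Re nu -> 0 < x ->
  besselJ_quot nu c x =
  cpow (x / 2) nu / cGamma (nu + 1) * hyp0F1 nu (c ^+ 2 * (x / 2) ^+ 2).
Proof.
move=> nu0 x0; apply: ccvg_clim.
have nu1 : 0 < Re (nu + 1) by rewrite ReD /=; lra.
have x2 : 0 < x / 2 by rewrite divr_gt0.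
apply: eq_ccvg (ccvgMl _ _ _ (ccvg_hyp0F1 nu _ nu0)) => N.
rewrite mulr_sumr; apply: eq_bigr => m _.
have -> : 2 * m%:R + nu = nu + (2 * m)%:R :> R[i] by rewrite natrM addrC.
rewrite cpow_addn// -(addrA m%:R) cGamma_poch// /hyp0F1_coef realM !realX.
rewrite !exprM exprMn.
have g0 := cGamma_neq0 _ nu1; have p0 := poch_neq0 _ m nu0.
have f0 : m`!%:R != 0 :> R[i] by rewrite pnatr_eq0 -lt0n fact_gt0.
move: (cGamma _) (poch _ _) (cpow _ _) g0 p0 => g p q g0 p0.
by field; rewrite g0 p0 f0.
Qed.

Lemma sum_expRN N y : 0 < y ->
  \sum_(1 <= n < N.+1) expR (- (n%:R * y)) = (1 - expR (- (N%:R * y))) / (expR y - 1).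
Proof.
move=> y0; have e1 : expR y - 1 != 0 by rewrite gt_eqF// subr_gt0 expR_gt1.
elim: N => [|N ih]; first by rewrite big_geq// mul0r oppr0 expR0 subrr mul0r.
rewrite big_nat_recr//= ih.
have -> : expR (- (N%:R * y)) = expR (- (N.+1%:R * y)) * expR y.
  by rewrite -expRD; congr expR; rewrite -natr1; ring.
by field.
Qed.

(** Since e^y - 1 = 2 e^(y / 2) sinh(y / 2). This one bound keeps the simple zero at 0 and
    exponential growth at infinity, so its inverse is of the form [pexp]. *)
Lemma expRB1_ge y : 0 < y -> y * expR (y / 2) <= expR y - 1.
Proof.
move=> y0; have := sqr_le_expRB (y / 2).
rewrite (_ : y / 2 *+ 2 = y); last by rewrite -mulr_natr divfK// pnatr_eq0.
have e0 := expR_gt0 (y / 2).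
have e1 : 1 < expR (y / 2) by rewrite expR_gt1 divr_gt0.
have e2 : expR (- (y / 2)) < 1 by rewrite expR_lt1 oppr_lt0 divr_gt0.
rewrite ler_sqr ?nnegrE ?(ltW y0)//; last by lra.
rewrite -(ler_pM2l e0) mulrBr -!expRD subrr expR0 -splitr mulrC.
by [].
Qed.

(** Summing the geometric series before estimating gives a bound free of N. The exponent is Re s -
    2, written so that [pexp_integrable] applies with p = Re s - 1. *)
Lemma normc_sum_bint_le N s nu b y : 0 <= Re nu -> 0 <= b -> 0 < y ->
  normc (\sum_(1 <= n < N.+1) bint n%:R b s nu y) <= pexp (Re s - 1 - 1) (1 / 2) y.
Proof.
move=> nu0 b0 y0; rewrite (le_trans (normc_sum _ _ _))//.
rewrite (@le_trans _ _ (\sum_(1 <= n < N.+1) expR (- (n%:R * y)) * expR ((Re s - 1) * ln y)))//.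
  apply: ler_sum => n _; rewrite (le_trans (normc_bint _ _ _ _ _ nu0 b0 y0))//.
  by rewrite /pexp expRD mulrC.
rewrite -mulr_suml sum_expRN//.
have -> : pexp (Re s - 1 - 1) (1 / 2) y =
    (y * expR (y / 2))^-1 * expR ((Re s - 1) * ln y).
  have -> : y * expR (y / 2) = expR (ln y + y / 2) by rewrite expRD lnK ?posrE.
  by rewrite -expRN -expRD /pexp; congr expR; ring.
have ye : 0 < y * expR (y / 2) by rewrite mulr_gt0 ?expR_gt0.
rewrite ler_wpM2r ?expR_ge0// -[leRHS]mul1r ler_pM//.
- rewrite subr_ge0 expR_le1 oppr_le0 mulr_ge0// ltW//.
- by rewrite invr_ge0 subr_ge0 ltW// expR_gt1.
- by rewrite lef_pV2 ?posrE ?expRB1_ge// subr_gt0 expR_gt1.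
Qed.

Definition bose_integrand s nu b y : R[i] :=
  ((expR y - 1)^-1)%:C * cpow y (s - 1) * hyp0F1 nu (b * y ^+ 2).

Lemma ccvg_real (f : nat -> R) (l : R) : f @ \oo --> l -> ccvg (fun n => (f n)%:C) l%:C.
Proof. by move=> fl; split=> //; exact: cvg_cst. Qed.

Lemma ccvg_bose s nu b y : 0 < y ->
  ccvg (fun N => \sum_(1 <= n < N.+1) bint n%:R b s nu y) (bose_integrand s nu b y).
Proof.
move=> y0; rewrite /bose_integrand -mulrA mulrC.
have h : (fun N => \sum_(1 <= n < N.+1) expR (- (n%:R * y))) @ \oo --> (expR y - 1)^-1.
  have -> : (fun N => \sum_(1 <= n < N.+1) expR (- (n%:R * y))) =
      (fun N => (1 - expR (- (N%:R * y))) * (expR y - 1)^-1).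
    by apply/funext => N; exact: sum_expRN.
  rewrite -[X in _ --> X]mul1r; apply: cvgMl.
  rewrite -[X in _ --> X]subr0; apply: cvgB; first exact: cvg_cst.
  apply: (@geometric_squeeze _ _ 1 y) => // n.
  by rewrite ger0_norm ?expR_ge0// mul1r mulrC.
apply: eq_ccvg (ccvgMl _ _ _ (ccvg_real _ _ h)) => N.
rewrite (big_morph (real_complex R) (id1 := 0) (op1 := +%R))//; last exact: realD.
by rewrite mulr_sumr; apply: eq_bigr => n _; rewrite /bint -[in RHS]mulrA mulrC.
Qed.

(** The bound in the last clause is uniform in N and in [b], hence in u and v; this lets it enter
    the dominating functions of the outer integrals as a constant. *)
Lemma bose_cint s nu b : 1 < Re s -> 0 <= Re nu -> 0 <= b ->
  [/\ cintegrable (bose_integrand s nu b),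
      ccvg (fun N => \sum_(1 <= n < N.+1) bessel_laplace n%:R b s nu)
        (cint (bose_integrand s nu b)) &
      forall N, normc (\sum_(1 <= n < N.+1) bessel_laplace n%:R b s nu) <=
        2 * \int[mu]_(y in D) pexp (Re s - 1 - 1) (1 / 2) y].
Proof.
move=> s1 nu0 b0.
have s0 : 0 < Re s by exact: lt_trans s1.
have ms N : cmeas (fun y => \sum_(1 <= n < N.+1) bint n%:R b s nu y).
  by apply: cmeas_sum => n; exact: cmeas_bint.
have ig : mu.-integrable D (EFin \o pexp (Re s - 1 - 1) (1 / 2)).
  by apply: pexp_integrable; [rewrite subr_gt0|rewrite divr_gt0].
have sE N : cint (fun y => \sum_(1 <= n < N.+1) bint n%:R b s nu y) =
    \sum_(1 <= n < N.+1) bessel_laplace n%:R b s nu.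
  (* [cint_sum] wants every member of the family integrable; the shift discards n = 0, where e^(- n
     y) gives no decay. *)
  have -> : (fun y => \sum_(1 <= n < N.+1) bint n%:R b s nu y) =
      (fun y => \sum_(0 <= n < N) bint n.+1%:R b s nu y).
    by apply/funext => y; rewrite big_add1.
  have [_ ->] := cint_sum _ (index_iota 0 N) (fun n => bint n.+1%:R b s nu)
    (fun n => cintegrable_bint _ _ _ _ (ltr0Sn _ n) b0 s0 nu0).
  by rewrite big_add1.
have [] := @cint_dominated_cvg R (fun N y => \sum_(1 <= n < N.+1) bint n%:R b s nu y)
  (bose_integrand s nu b) _ ms ig.
- by move=> N y y0; exact: normc_sum_bint_le.
- by move=> y y0; exact: ccvg_bose.
move=> iB cB.
split=> //; first by apply: eq_ccvg cB.
move=> N; rewrite -sE; apply: normc_cint_le => // y y0.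
exact: normc_sum_bint_le.
Qed.

Definition zeta_term w s c n v u : R[i] :=
  cpow (u * v) (s - 1) * (expR (- (u ^+ 2 + v ^+ 2)))%:C
    * csin (w * v%:C) * csinh (w * u%:C)
    / cpow (n%:R ^+ 2 * u ^+ 2 + c ^+ 2 * v ^+ 2) (s / 2).

(** What remains of the integrand after factoring n^2 u^2 + c^2 v^2 = u^2 (n^2 + 4 b), with b given
    by [slope]: the powers of u combine to u^(s - 1) / u^s = 1 / u. *)
Definition zeta_weight w s v u : R[i] :=
  cpow v (s - 1) * ((expR (- (u ^+ 2 + v ^+ 2)))%:C * csin (w * v%:C) * csinh (w * u%:C)) / u%:C.

Definition slope c v u : R := (c * (v / u / 2)) ^+ 2.

Lemma zeta_termE w s c n v u : 1 < Re s -> (0 < n)%N -> 0 < u -> 0 < v ->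
  zeta_term w s c n v u = zeta_weight w s v u / cGamma s
    * bessel_laplace n%:R (slope c v u) s ((s - 1) / 2).
Proof.
move=> s1 n0 u0 v0.
have s0 : 0 < Re s by exact: lt_trans s1.
have nu0 : 0 <= Re ((s - 1) / 2) by rewrite Re_half ReD ReN /= divr_ge0// subr_ge0 ltW.
have b0 : 0 <= slope c v u by exact: sqr_ge0.
have n1 : 0 <= n%:R - 1 :> R by rewrite subr_ge0 ler1n.
have sE : s = 2 * ((s - 1) / 2) + 1 by rewrite mulrC divfK ?pnatr_eq0// subrK.
have g0 := cGamma_neq0 _ s0.
have q0 : 0 < n%:R ^+ 2 + 4 * slope c v u.
  by apply: ltr_wpDr; [exact: mulr_ge0|rewrite exprn_gt0// ltr0n].
(* Here ka = n - 1, nonnegative since n >= 1. *)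
have := bessel_laplaceE _ _ _ _ sE n1 b0 nu0.
rewrite (addrC 1) subrK => h.
have -> : bessel_laplace n%:R (slope c v u) s ((s - 1) / 2) =
    cGamma s / cpow (n%:R ^+ 2 + 4 * slope c v u) (s / 2).
  by rewrite -h mulfK// cpow_neq0.
have qE : n%:R ^+ 2 * u ^+ 2 + c ^+ 2 * v ^+ 2 =
    (n%:R ^+ 2 + 4 * slope c v u) * u ^+ 2.
  by rewrite /slope; field; rewrite gt_eqF.
rewrite /zeta_term qE.
rewrite /zeta_weight cpowMl// cpowMl ?exprn_gt0// cpow_sqr// (cpow_subr1 u)//.
have c1 := cpow_neq0 u s.
have c2 := cpow_neq0 (n%:R ^+ 2 + 4 * slope c v u) (s / 2).
have u1 := real_neq0 _ u0.
move: (csin _) (csinh _) (expR _)%:C (cpow v _) => e1 e2 e3 r.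
move: (cGamma s) (cpow u s) (cpow _ (s / 2)) g0 c1 c2 => g p q g0 c1 c2.
by field; rewrite g0 c1 c2 u1.
Qed.

(** The bound is a product in v and u, so one integration leaves a bound for the next;
    [pexp (1 - 1) 1 u] is e^(- u) in the shape [pexp_integrable] expects. *)
Lemma zeta_weight_le w s : exists2 C : R, 0 <= C & forall u v, 0 < u -> 0 < v ->
  normc (zeta_weight w s v u) <= C * pexp (Re s - 1) 1 v * pexp (1 - 1) 1 u.
Proof.
pose A := `|Re w| + `|Im w|.
(* The maximum of (r + 1) t - t^2 over t: the Gaussian absorbs e^(r t) and still leaves e^(- t). *)
pose k (r : R) := (r + 1) ^+ 2 / 4.
have kP (r t : R) : r * t - t ^+ 2 <= k r - t.
  rewrite -subr_ge0 (_ : _ - _ = (t - (r + 1) / 2) ^+ 2) ?sqr_ge0//.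
  by rewrite /k; field.
exists (A * expR (k `|Re w| + k `|Im w|)) => [|u v u0 v0].
  by rewrite mulr_ge0 ?expR_ge0// addr_ge0.
rewrite /zeta_weight normcM normcV normcM normc_cpow normcM normcM !normc_real.
rewrite (ger0_norm (expR_ge0 _)) (ger0_norm (ltW u0)) ler_pdivrMr// ReD ReN /=.
have h1 := normc_csin_le w _ (ltW v0).
have h2 := normc_csinh_le w _ (ltW u0).
apply: (@le_trans _ _ (expR ((Re s - 1) * ln v) * (expR (- (u ^+ 2 + v ^+ 2)) *
    expR (`|Im w| * v) * (A * u * expR (`|Re w| * u))))).
  rewrite ler_wpM2l ?expR_ge0// ler_pM ?mulr_ge0 ?normc_ge0 ?expR_ge0//.
  by rewrite ler_wpM2l ?expR_ge0.
have A0 : 0 <= A by rewrite addr_ge0.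
have -> : expR ((Re s - 1) * ln v) * (expR (- (u ^+ 2 + v ^+ 2)) *
    expR (`|Im w| * v) * (A * u * expR (`|Re w| * u))) =
   A * u * (expR ((Re s - 1) * ln v) * expR (- (u ^+ 2 + v ^+ 2)) *
    expR (`|Im w| * v) * expR (`|Re w| * u)) by ring.
rewrite /pexp.
have -> : A * expR (k `|Re w| + k `|Im w|) * expR ((Re s - 1) * ln v - 1 * v) *
    expR ((1 - 1) * ln u - 1 * u) * u = A * u * (expR (k `|Re w| + k `|Im w|) *
    expR ((Re s - 1) * ln v - 1 * v) * expR ((1 - 1) * ln u - 1 * u)) by ring.
rewrite ler_wpM2l ?mulr_ge0 ?(ltW u0)// -!expRD ler_expR.
by have := kP `|Re w| u; have := kP `|Im w| v; lra.
Qed.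

(** Coordinates on an arbitrary space let one statement serve both the product space and the
    sections at fixed v. *)
Lemma cmeas_zeta_term w s c n d (T : measurableType d) (V U : T -> R) :
  measurable_fun setT V -> measurable_fun setT U ->
  cmeas (fun t => zeta_term w s c n (V t) (U t)).
Proof.
move=> mV mU; rewrite /zeta_term.
(* The quotient becomes a product with a negative exponent, since measurability is known for
   products and powers. *)
have -> : (fun t => cpow (U t * V t) (s - 1) * (expR (- (U t ^+ 2 + V t ^+ 2)))%:C
    * csin (w * (V t)%:C) * csinh (w * (U t)%:C)
    / cpow (n%:R ^+ 2 * U t ^+ 2 + c ^+ 2 * V t ^+ 2) (s / 2)) =
  (fun t => cpow (U t * V t) (s - 1) * (expR (- (U t ^+ 2 + V t ^+ 2)))%:C
    * csin (w * (V t)%:C) * csinh (w * (U t)%:C)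
    * cpow (n%:R ^+ 2 * U t ^+ 2 + c ^+ 2 * V t ^+ 2) (- (s / 2))).
  by apply/funext => t; rewrite cpowN.
have mU2 : measurable_fun setT (fun t => U t ^+ 2) by exact: measurable_funX.
have mV2 : measurable_fun setT (fun t => V t ^+ 2) by exact: measurable_funX.
apply: cmeasM; last first.
  apply: cmeas_cpow; apply: measurable_funD; apply: measurable_funM => //;
    exact: measurable_cst.
apply: cmeasM; last first.
  by apply: cmeas_csinh; apply: cmeasM (cmeas_cst _) _; exact: cmeas_real.
apply: cmeasM; last first.
  by apply: cmeas_csin; apply: cmeasM (cmeas_cst _) _; exact: cmeas_real.
apply: cmeasM; first by apply: cmeas_cpow; exact: measurable_funM.
apply: cmeas_real; apply: (measurableT_comp (f := @expR R)) => //.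
by apply: measurable_funN; exact: measurable_funD.
Qed.
End bessel_series.

(** * Exchanging the sum over n with the integrals in u and v *)

Section zeta_integrals.
Context {R : realType}.
Local Notation mu := (@lebesgue_measure R).
Local Notation D := (`]0, +oo[%classic : set R).
Variables (w s : R[i]) (c : R).
Hypothesis hs : 1 < Re s.
Local Notation nu := ((s - 1) / 2).

Let s0 : 0 < Re s. Proof. exact: lt_trans hs. Qed.

Let nu0 : 0 <= Re nu.
Proof. by rewrite Re_half ReD ReN /= divr_ge0// subr_ge0 ltW. Qed.

Let nu1 : 0 < Re (nu + 1). Proof. by rewrite ReD ltr_wpDl. Qed.

Let term := zeta_term w s c.

Let S N v u := \sum_(1 <= n < N.+1) term n v u.

Let Soo v u := zeta_weight w s v u / cGamma s * cint (bose_integrand s nu (slope c v u)).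

Let SE N v u : 0 < v -> 0 < u -> S N v u = zeta_weight w s v u / cGamma s *
  \sum_(1 <= n < N.+1) bessel_laplace n%:R (slope c v u) s nu.
Proof.
move=> v0 u0; rewrite mulr_sumr; apply: eq_big_nat => n /andP[n0 _].
exact: zeta_termE.
Qed.

Let cvgS v u : 0 < v -> 0 < u -> ccvg (fun N => S N v u) (Soo v u).
Proof.
move=> v0 u0; have [_ cB _] := bose_cint s nu (slope c v u) hs nu0 (sqr_ge0 _).
by apply: eq_ccvg (ccvgMl _ _ _ cB) => N; rewrite SE.
Qed.

Let boundS : exists2 C : R, 0 <= C & forall N v u, 0 < v -> 0 < u ->
  normc (S N v u) <= C * pexp (Re s - 1) 1 v * pexp (1 - 1) 1 u.
Proof.
have [C C0 hC] := zeta_weight_le w s.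
set Z := 2 * \int[mu]_(y in D) pexp (Re s - 1 - 1) (1 / 2) y.
have Z0 : 0 <= Z.
  by rewrite mulr_ge0// Rintegral_ge0// => y _; exact: pexp_ge0.
exists (C * (normc (cGamma s))^-1 * Z) => [|N v u v0 u0].
  by rewrite mulr_ge0// divr_ge0// normc_ge0.
have [_ _ hB] := bose_cint s nu (slope c v u) hs nu0 (sqr_ge0 _).
rewrite SE// normcM normcM normcV.
apply: (@le_trans _ _ (C * pexp (Re s - 1) 1 v * pexp (1 - 1) 1 u / normc (cGamma s) * Z)).
  apply: ler_pM.
  - by rewrite mulr_ge0 ?invr_ge0 ?normc_ge0.
  - exact: normc_ge0.
  - by rewrite ler_wpM2r ?invr_ge0 ?normc_ge0// hC.
  - exact: hB.
by rewrite le_eqVlt; apply/orP; left; apply/eqP; ring.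
Qed.

(** A term is the difference of two consecutive partial sums, so the bound on sums serves for terms
    at twice the constant. *)
Let boundT : exists2 C : R, 0 <= C & forall n v u, 0 < v -> 0 < u ->
  normc (term n.+1 v u) <= C * pexp (Re s - 1) 1 v * pexp (1 - 1) 1 u.
Proof.
have [C C0 hC] := boundS; exists (C + C) => [|n v u v0 u0]; first exact: addr_ge0.
have -> : term n.+1 v u = S n.+1 v u - S n v u.
  by rewrite /S big_nat_recr//= (addrC (\sum_(_ <= _ < _) _)) addrK.
by rewrite (le_trans (le_normcD _ _))// normcN !mulrDl lerD// hC.
Qed.

Let ip : mu.-integrable D (EFin \o pexp (1 - 1) 1).
Proof. exact: pexp_integrable. Qed.

Let iv : mu.-integrable D (EFin \o pexp (Re s - 1) 1).
Proof. exact: pexp_integrable. Qed.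

Let cintegrable_term n v : 0 < v -> cintegrable (term n.+1 v).
Proof.
move=> v0; have [C C0 hC] := boundT.
apply: (@dominated_cintegrable _ _ (fun u => C * pexp (Re s - 1) 1 v * pexp (1 - 1) 1 u)).
- by apply: cmeas_zeta_term => //; exact: measurable_cst.
- exact: RintegrableZ.
- by move=> u u0; exact: hC.
Qed.

Let cmeas_term n : cmeas (fun v => cint (term n v)).
Proof.
apply: (@cmeas_cint_param _ (fun z => term n z.1 z.2)).
by apply: cmeas_zeta_term; [exact: measurable_fst|exact: measurable_snd].
Qed.

Let cint_S N v : 0 < v -> cint (S N v) = \sum_(1 <= n < N.+1) cint (term n v).
Proof.
move=> v0; have -> : S N v = (fun u => \sum_(0 <= n < N) term n.+1 v u).
  by apply/funext => u; rewrite /S big_add1.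
have [_ ->] := cint_sum _ (index_iota 0 N) (fun n => term n.+1 v)
  (fun n => cintegrable_term n v v0).
by rewrite big_add1.
Qed.

Let inner v : 0 < v -> cintegrable (Soo v) /\
  ccvg (fun N => \sum_(1 <= n < N.+1) cint (term n v)) (cint (Soo v)).
Proof.
move=> v0; have [C C0 hC] := boundS.
have [] := @cint_dominated_cvg R (fun N => S N v) (Soo v)
  (fun u => C * pexp (Re s - 1) 1 v * pexp (1 - 1) 1 u).
- move=> N; apply: cmeas_sum => n.
  by apply: cmeas_zeta_term => //; exact: measurable_cst.
- exact: RintegrableZ.
- by move=> N u u0; exact: hC.
- by move=> u u0; exact: cvgS.
by move=> iS cS; split=> //; apply: eq_ccvg cS => N; rewrite cint_S.
Qed.

(** Integrating the product bound in u leaves a multiple of [pexp (Re s - 1) 1 v], which dominates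
    the v integrals of single terms and of partial sums alike. *)
Let outer : cintegrable (fun v => cint (Soo v)) /\
  ccvg (fun N => \sum_(1 <= n < N.+1) cint (fun v => cint (term n v)))
       (cint (fun v => cint (Soo v))).
Proof.
have [C C0 hC] := boundS; have [C' C'0 hC'] := boundT.
set I := \int[mu]_(u in D) pexp (1 - 1) 1 u.
have bnd (K : R) (f : R -> R[i]) v : cmeas f -> 0 < v ->
    (forall u, 0 < u -> normc (f u) <= K * pexp (Re s - 1) 1 v * pexp (1 - 1) 1 u) ->
    normc (cint f) <= 2 * K * I * pexp (Re s - 1) 1 v.
  move=> mf v0 hf; rewrite (le_trans (normc_cint_le _ _ mf (RintegrableZ _ _ ip) hf))//.
  rewrite RintegralZl// -/I le_eqVlt; apply/orP; left; apply/eqP; ring.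
have mt n v : cmeas (term n v).
  by apply: cmeas_zeta_term => //; exact: measurable_cst.
have it n : cintegrable (fun v => cint (term n.+1 v)).
  apply: (@dominated_cintegrable _ _ (fun v => 2 * C' * I * pexp (Re s - 1) 1 v)).
  - exact: cmeas_term.
  - exact: RintegrableZ.
  - by move=> v v0; apply: bnd => // u u0; exact: hC'.
have [] := @cint_dominated_cvg R (fun N v => \sum_(1 <= n < N.+1) cint (term n v))
  (fun v => cint (Soo v)) (fun v => 2 * C * I * pexp (Re s - 1) 1 v).
- by move=> N; apply: cmeas_sum => n; exact: cmeas_term.
- exact: RintegrableZ.
- move=> N v v0; rewrite -cint_S//; apply: bnd => //; first exact: cmeas_sum.
  by move=> u u0; exact: hC.
- by move=> v /inner[].
move=> iS cS; split=> //; apply: eq_ccvg cS => N.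
have -> : (fun v => \sum_(1 <= n < N.+1) cint (term n v)) =
    (fun v => \sum_(0 <= n < N) cint (term n.+1 v)).
  by apply/funext => v; rewrite big_add1.
have [_ ->] := cint_sum _ (index_iota 0 N) (fun n v => cint (term n.+1 v)) it.
by rewrite big_add1.
Qed.

Lemma clim_zeta_term :
  clim (fun N => \sum_(1 <= n < N.+1) cint (fun v => cint (fun u => zeta_term w s c n v u)))
  = cint (fun v => cint (fun u =>
      zeta_weight w s v u / cGamma s * cint (bose_integrand s nu (slope c v u)))).
Proof. by have [_ /ccvg_clim] := outer. Qed.

(** Since 2 nu = s - 1, the product (u v)^nu y^nu (v y / (2 u))^nu equals 2^(- nu) v^(s - 1) y^(s -
    1): the powers of u cancel and only the explicit 1 / u survives. *)
Lemma cint_besselJ_quot v u : 0 < v -> 0 < u ->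
  cint (fun y : R =>
    cpow (u * v) nu / u%:C
      * ((expR (- (u ^+ 2 + v ^+ 2)))%:C * csin (w * v%:C) * csinh (w * u%:C)
          / (expR y - 1)%:C)
      * besselJ_quot nu c (v * y / u) * cpow y nu) =
  cGamma s / (cpow 2 nu * cGamma (nu + 1)) * Soo v u.
Proof.
move=> v0 u0.
have [iB _ _] := bose_cint s nu (slope c v u) hs nu0 (sqr_ge0 _).
have gs := cGamma_neq0 _ s0; have gn := cGamma_neq0 _ nu1.
have c2 := cpow_neq0 2 nu; have u1 := real_neq0 _ u0; have cu := cpow_neq0 u nu.
rewrite /Soo mulrA -cintMl//; apply: eq_cint => y y0.
have x0 : 0 < v * y / u by rewrite divr_gt0// mulr_gt0.
have e0 : (expR y - 1)%:C != 0 :> R[i] by rewrite real_neq0// subr_gt0 expR_gt1.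
have sE : s - 1 = nu + nu by exact: splitr.
rewrite besselJ_quot_hyp0F1// /bose_integrand /zeta_weight.
have -> : c ^+ 2 * (v * y / u / 2) ^+ 2 = slope c v u * y ^+ 2.
  by rewrite /slope; field; rewrite gt_eqF.
have -> : v * y / u / 2 = v * y * u^-1 * 2^-1 by [].
rewrite !cpowMl ?invr_gt0// ?mulr_gt0 ?invr_gt0// !cpow_inv//.
rewrite sE !cpowD -sE realV.
move: (cpow 2 _) (cpow u _) (cpow v _) (cpow y _) (cGamma s) (cGamma (nu + 1)) (hyp0F1 _ _)
  c2 cu gs gn => k p q r g h f c2 cu gs gn.
move: (csin _) (csinh _) (expR (- _))%:C => e1 e2 e3.
move: (_ - _)%:C e0 => m e0.
by field; rewrite c2 cu gs gn e0 u1.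
Qed.

Lemma cint_cint_besselJ_quot (k : R[i]) :
  cint (fun v => cint (fun u => k * Soo v u)) = k * cint (fun v => cint (fun u => Soo v u)).
Proof.
rewrite -cintMl; last by have [] := outer.
by apply: eq_cint => v /inner[iS _]; rewrite cintMl.
Qed.
End zeta_integrals.

(** * Assembly and comparison of the constant factors *)

Theorem theorem4p5 (R : realType) (w s : R[i]) (a : R)
    (hw : w != 0) (hs : 1 < complex.Re s) :
  zeta_w w s a =
  cpow 2 ((s + 3) / 2) / (w ^+ 2 * (Num.sqrt pi)%:C * cGamma s) *
  cint (fun v : R => cint (fun u : R => cint (fun y : R =>
    cpow (u * v) ((s - 1) / 2) / u%:C
      * ((expR (- (u ^+ 2 + v ^+ 2)))%:C * csin (w * v%:C) * csinh (w * u%:C)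
          / (expR y - 1)%:C)
      * besselJ_quot ((s - 1) / 2) (a - 1) (v * y / u)
      * cpow y ((s - 1) / 2)))).
Proof.
have s0 : 0 < Re s by exact: lt_trans hs.
set nu := (s - 1) / 2.
have s1E : (s + 1) / 2 = nu + 1.
  by rewrite /nu; field.
have s3E : (s + 3) / 2 = nu + 2%:R by rewrite /nu; field.
have -> : cint (fun v : R => cint (fun u : R => cint (fun y : R =>
    cpow (u * v) nu / u%:C
      * ((expR (- (u ^+ 2 + v ^+ 2)))%:C * csin (w * v%:C) * csinh (w * u%:C)
          / (expR y - 1)%:C)
      * besselJ_quot nu (a - 1) (v * y / u) * cpow y nu))) =
  cint (fun v : R => cint (fun u : R => cGamma s / (cpow 2 nu * cGamma (nu + 1)) *
    (zeta_weight w s v u / cGamma s * cint (bose_integrand s nu (slope (a - 1) v u))))).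
  by apply: eq_cint => v v0; apply: eq_cint => u u0; exact: cint_besselJ_quot.
rewrite (cint_cint_besselJ_quot w s (a - 1) hs) -(clim_zeta_term w s (a - 1) hs).
rewrite /zeta_w -/(zeta_term _ _ _ _ _ _).
move: (clim _) => X; rewrite [RHS]mulrA; congr (_ * _).
have gs := cGamma_neq0 _ s0; have c2 := cpow_neq0 2 nu.
(* Now 2^((s + 3) / 2) = 4 2^nu, so 2^nu and Gamma(s) cancel and 4 / Gamma(nu + 1) remains, as in
   [zeta_w]. *)
rewrite s1E s3E cpow_addn//.
have p0 : (Num.sqrt pi)%:C != 0 :> R[i] by rewrite real_neq0// sqrtr_gt0 pi_gt0.
have g1 : cGamma (nu + 1) != 0.
  by apply: cGamma_neq0; rewrite -s1E Re_half ReD /=; lra.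
rewrite real_natr.
move: (cGamma s) (cGamma _) (cpow _ _) (_ %:C) gs g1 c2 p0 => g h k p gs g1 c2 p0.
by field; rewrite gs g1 c2 p0 hw.
Qed.
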